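(* Let $\mathcal{X}$ be a finite set, $d\ge 1$, $\pi\in\mathcal{P}(\mathcal{X})$, $\rho\in\mathcal{P}(\mathbb{R}^d)$, $\hat\pi=\pi\otimes\rho$, and let $\hat{\mathcal{L}}=\hat{\mathcal{L}}^H+\gamma\hat{\mathcal{L}}^D_p$ be the generator described in the context, with domain $\hat{\mathcal{D}}\subset L^2(\hat\pi)$ and with $C^\infty_c(\mathcal{X}\times\mathbb{R}^d)$ as a core. Assume $Q_{x,y}(p)=0$ whenever $\{x,y\}\not\subset\mathrm{supp}(\pi)$ and, for $(x,p)\in\mathcal{X}\times\mathbb{R}^d$, define $$q_x(p):=\sum_{y\in\mathcal{X}}Q_{y,x}(p)\frac{\pi_y}{\pi_x}=\sum_{y\ne x}\Big[Q_{y,x}(p)\frac{\pi_y}{\pi_x}-Q_{x,y}(p)\Big],$$ with the convention $q_x(p)=0$ for $x\notin\mathrm{supp}(\pi)$. Then the Markov process generated by $\hat{\mathcal{L}}$ is $\hat\pi$-invariant if and only if, for $\pi$-a.e. $x\in\mathcal{X}$, $\nabla_p\cdot(\rho\mu_x)=\rho q_x$ in the distributional sense, i.e. $$\int_{\mathbb{R}^d}\langle\nabla_p f,\mu_x\rangle\,\mathrm{d}\rho=-\int_{\mathbb{R}^d}f\,q_x\,\mathrm{d}\rho\qquad\text{for all } f\in C^\infty_c(\mathbb{R}^d).$$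
   Context: $\mathcal{X}$ is a finite set. For each $p\in\mathbb{R}^d$, $Q(p)\in\mathbb{R}^{\mathcal{X}\times\mathcal{X}}$ is the generator of a continuous-time Markov chain on $\mathcal{X}$: $Q_{x,y}(p)\ge 0$ for $x\ne y$ and $Q_{x,x}(p)=-\sum_{y\ne x}Q_{x,y}(p)$. $\mu:\mathcal{X}\times\mathbb{R}^d\to\mathbb{R}^d$, $(x,p)\mapsto\mu_x(p)$, is a drift function. All components of $p\mapsto Q(p)$ and of $p\mapsto\mu(p)$ are in $L^2(\rho)$. For test functions $f:\mathcal{X}\times\mathbb{R}^d\to\mathbb{R}$, $$\hat{\mathcal{L}}^H f(x,p)=\sum_{y\in\mathcal{X}}Q_{x,y}(p)f(y,p)+\langle\mu_x(p),\nabla_p f(x,p)\rangle .$$ $\hat{\mathcal{L}}^D_p=\mathrm{Id}\otimes\mathcal{L}^D_p$ (acting only on the $p$ variable), where $\mathcal{L}^D_p$ is the generator of a $\rho$-invariant Markov process on $\mathbb{R}^d$, for instance the full refreshment $\hat{\mathcal{L}}^D_pf(x,p)=\int_{\mathbb{R}^d}(f(x,p')-f(x,p))\,\mathrm{d}\rho(p')$, and $\gamma\ge0$. It is assumed that there exists a unique Markov process $(Z_t)_{t\ge0}=(X_t,P_t)_{t\ge 0}$ on $\mathcal{X}\times\mathbb{R}^d$ with generator $\hat{\mathcal{L}}=\hat{\mathcal{L}}^H+\gamma\hat{\mathcal{L}}^D_p$. $C^\infty_c(\mathcal{X}\times\mathbb{R}^d)$ denotes the functions $f$ such that $f(x,\cdot)$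 is smooth and compactly supported for each $x\in\mathcal{X}$. Standing assumption: $\hat{\mathcal{L}}$ has domain $\hat{\mathcal{D}}\subset L^2(\hat\pi)$ and $C^\infty_c(\mathcal{X}\times\mathbb{R}^d)$ is a core for it. *)

(* Defs.v *)
From HB Require Import structures.
From mathcomp Require Import all_boot all_order all_algebra.
From mathcomp Require Import all_classical all_reals all_analysis.

Set Implicit Arguments.
Unset Strict Implicit.
Unset Printing Implicit Defensive.

Import Order.TTheory GRing.Theory Num.Theory.
Import numFieldNormedType.Exports.

Local Open Scope classical_set_scope.
Local Open Scope ring_scope.

(* Measurable types of the library are pointed, hence a finite set is a finite
   pointed type; a set that carries a probability measure is nonempty anyway. *)
#[short(type="pfinType")]
HB.structure Definition PointedFinite := {T of Finite T & isPointed T}.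

Definition discrete_fin (X : pfinType) : Type := X.

HB.instance Definition _ (X : pfinType) := Pointed.on (discrete_fin X).
HB.instance Definition _ (X : pfinType) :=
  @isMeasurable.Build default_measure_display (discrete_fin X)
    discrete_measurable discrete_measurable0
    (@discrete_measurableC X) (@discrete_measurableU X).

(* [borel_rV R d] is convertible to ['rV[R]_d]; the alias carries the Borel
   sigma-algebra, whereas topology and derivatives live on ['rV[R]_d]. *)
Notation borel_rV R d := (g_sigma_algebraType (@open 'rV[R]_d)).
Notation phase X R d := (discrete_fin X * borel_rV R d)%type.

Section test_functions.
Context {R : realType} {d : nat}.
Implicit Types f : 'rV[R]_d -> R.

Definition pderiv (i : 'I_d) f (p : 'rV[R]_d) : R := 'D_(delta_mx 0 i) f p.

Definition grad f (p : 'rV[R]_d) : 'rV[R]_d := \row_i pderiv i f p.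

Definition dotp (u v : 'rV[R]_d) : R := \sum_(i < d) u 0 i * v 0 i.

Fixpoint class_C (k : nat) f : Prop :=
  match k with
  | 0%N => continuous f
  | k'.+1 => continuous f /\
      forall i : 'I_d, (forall p : 'rV[R]_d, derivable f p (delta_mx 0 i)) /\
        class_C k' (pderiv i f)
  end.

Definition smooth f := forall k, class_C k f.

Definition test_rV f := smooth f /\ compact (closure [set p | f p != 0]).

Definition test_phase (X : pfinType) (f : phase X R d -> R) :=
  forall x : X, test_rV (fun p : 'rV[R]_d => f (x, p)).

End test_functions.

(* A Markov process is represented by its transition kernels [P t], t >= 0
   (the values of [P] at negative times are irrelevant). *)
Section markov.
Context (disp : measure_display) (T : measurableType disp) (R : realType).
Implicit Types (m : {measure set T -> \bar R}) (P : R -> R.-pker T ~> T).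

Definition L2 m : {pred T -> R} := Lfun m 2%:E.

Definition norm2 m (f : T -> R) : \bar R := 'N[m]_(2%:E)[EFin \o f]%E.

Definition transition_function P :=
  (forall z A, measurable A -> P 0 z A = \d_z A) /\
  (forall s t, 0 <= s -> 0 <= t -> forall z A, measurable A ->
     P (s + t) z A = (\int[P s z]_y P t y A)%E).

Definition kact P (t : R) (f : T -> R) (z : T) : R := \int[P t z]_y f y.

Definition invariant_measure m P :=
  forall t, 0 <= t -> forall A, measurable A -> (\int[m]_z P t z A)%E = m A.

Definition C0_semigroup m P :=
  (forall t, 0 <= t -> exists M : R, forall f, f \in L2 m ->
     kact P t f \in L2 m /\
     (norm2 m (kact P t f) <= M%:E * norm2 m f)%E) /\
  (forall f, f \in L2 m ->
     norm2 m (fun z => kact P t f z - f z) @[t --> 0^'+] --> 0%E).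

Definition generates m P (f g : T -> R) :=
  [/\ f \in L2 m, g \in L2 m &
      norm2 m (fun z => t^-1 * (kact P t f z - f z) - g z)
        @[t --> 0^'+] --> 0%E].

(* [D] and [L] are stated on functions rather than on classes modulo
   [m]-a.e. equality; [L f] is meaningful up to [m]-a.e. equality only. *)
Definition has_generator m P (D : set (T -> R)) (L : (T -> R) -> T -> R) :=
  [/\ transition_function P, C0_semigroup m P,
      D = [set f | exists g, generates m P f g] &
      forall f, D f -> generates m P f (L f)].

Definition is_core m (D : set (T -> R)) (L : (T -> R) -> T -> R)
    (C : set (T -> R)) :=
  C `<=` D /\
  forall f, D f -> forall e : R, 0 < e -> exists2 g, C g &
    (norm2 m (fun z => f z - g z)%R < e%:E)%E /\
    (norm2 m (fun z => L f z - L g z)%R < e%:E)%E.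

(* An L^2(m) generator cannot see an [m]-null set of starting points. *)
Definition unique_process m P (D : set (T -> R)) (L : (T -> R) -> T -> R) :=
  forall P', has_generator m P' D L ->
  forall t, 0 <= t -> forall A, measurable A ->
    {ae m, forall z, P' t z A = P t z A}.

End markov.

Section jump_drift.
Context {X : pfinType} {R : realType} {d : nat}.
Implicit Types (Q : X -> X -> 'rV[R]_d -> R) (mu : X -> 'rV[R]_d -> 'rV[R]_d)
  (pi : probability (discrete_fin X) R) (rho : probability (borel_rV R d) R).

Definition rate_matrix Q (p : 'rV[R]_d) :=
  (forall x y, x != y -> 0 <= Q x y p) /\
  (forall x, Q x x p = - \sum_(y | y != x) Q x y p).

Definition LH Q mu (f : phase X R d -> R) (z : phase X R d) : R :=
  \sum_(y : X) Q z.1 y z.2 * f (y, z.2) +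
  dotp (mu z.1 z.2) (grad (fun p : 'rV[R]_d => f (z.1, p)) z.2).

(* Id (x) LD *)
Definition lift_p (LD : (borel_rV R d -> R) -> borel_rV R d -> R)
    (f : phase X R d -> R) (z : phase X R d) : R :=
  LD (fun p => f (z.1, p)) z.2.

Definition pmass pi (x : X) : R := fine (pi [set x]).

Definition psupp pi : set X := [set x | 0 < pmass pi x].

Definition q_ pi Q (x : X) (p : 'rV[R]_d) : R :=
  if x \in psupp pi then \sum_(y : X) Q y x p * (pmass pi y / pmass pi x) else 0.

Lemma q_E pi Q x p : rate_matrix Q p -> psupp pi x ->
  q_ pi Q x p =
  \sum_(y | y != x) (Q y x p * (pmass pi y / pmass pi x) - Q x y p).
Proof.
move=> [_ Qd] sx; rewrite /q_ mem_set// (bigD1 x)//= divff ?mulr1; last first.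
  by rewrite gt_eqF.
by rewrite sumrB addrC Qd.
Qed.

(* div(rho m) = rho q in the sense of distributions. *)
Definition weighted_div_eq rho (m : 'rV[R]_d -> 'rV[R]_d) (q : 'rV[R]_d -> R) :=
  forall f : 'rV[R]_d -> R, test_rV f ->
    \int[rho]_p dotp (grad f p) (m p) = - \int[rho]_p (f p * q p).

End jump_drift.

(* Main.v *)
Require Import Defs.
From HB Require Import structures.
From mathcomp Require Import all_boot all_order all_algebra.
From mathcomp Require Import all_classical all_reals all_analysis.
From mathcomp Require Import measurable_realfun ring lra.

Set Implicit Arguments.
Unset Strict Implicit.
Unset Printing Implicit Defensive.

Import Order.TTheory GRing.Theory Num.Theory.
Import numFieldNormedType.Exports.

Local Open Scope classical_set_scope.
Local Open Scope ring_scope.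

(* Let [m] be [pi x rho] and [m_t] the law at time [t] of the process started
   from [m].  The L^2 bounds on the semigroup give L^2(m) inside L^1(m_t), and
   [m_h f - m f = h (m (L f) + o(1))] for [f] in the domain.  Invariance thus
   forces [m (L f) = 0].  Conversely, if [m (L f) = 0] on the core, then on the
   whole domain, hence [m_s (L f) = m (L (P_s f)) = 0] for every [s]; summing
   [m_((k+1)h) f - m_(kh) f = m_(kh) (P_h f - f)] over [k] shows
   [m_t f = m f], because the functionals [m_s] are bounded on L^2(m) uniformly
   for small [s].  Test functions are measure determining, so [m_t = m].
   Finally, for a test function [f], [m (L f)] is the sum over [x] of
   [pi_x (int <grad f_x, mu_x> drho + int f_x q_x drho)], the [L^D] part
   being [rho]-invariant; the functions supported on [{x} x R^d] isolate each
   term of this sum. *)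

(** * Mixtures of kernels and L^2 bounds *)

(** The obstacle is that the semigroup comes with one L^2 bound for each time and no uniformity in
    time. In the telescoping sum the errors are integrated against the laws at all the grid times,
    so their total is controlled only by a bound common to these laws. Strong continuity at 0
    supplies such a bound on a short interval [[0, h]], and longer times are reached in blocks of
    length [h]. A second obstacle is that [kact] is a real integral, which takes a default value
    where the function is not integrable. Integrability therefore precedes every algebraic identity
    on [kact]: it is obtained for almost every starting point from the inclusion of L^2(m) in
    L^1(m_t), and the semigroup law on functions holds almost everywhere only. Such m-null sets are
    harmless under the later laws too, because the L^2 bound makes each law absolutely continuous
    with respect to [m]. *)

Section mixture.
Context (d1 d2 : measure_display) (T : measurableType d1)
  (U : measurableType d2) (R : realType).
Variables (nu : {measure set T -> \bar R}) (k : R.-ker T ~> U).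
Local Open Scope ereal_scope.

Definition mixture (A : set U) : \bar R := \int[nu]_z k z A.

Let mixture0 : mixture set0 = 0.
Proof. by apply: integral0_eq => z _; rewrite measure0. Qed.

Let mixture_ge0 A : 0 <= mixture A.
Proof. by apply: integral_ge0. Qed.

Let mixture_semi_sigma_additive : semi_sigma_additive mixture.
Proof.
move=> F mF tF mUF; rewrite [X in _ --> X](_ : _ =
    \int[nu]_z (\sum_(0 <= i <oo) k z (F i))); last first.
  apply: eq_integral => z _.
  by apply/esym/cvg_lim => //; exact: measure_semi_sigma_additive.
apply/cvg_closeP; split.
  by apply: is_cvg_nneseries => n _ _; exact: integral_ge0.
rewrite closeE// integral_nneseries// => n.
exact: measurable_kernel.
Qed.

HB.instance Definition _ := isMeasure.Build _ _ R mixture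
  mixture0 mixture_ge0 mixture_semi_sigma_additive.

End mixture.

Section mixture_integral.
Context (d1 d2 : measure_display) (T : measurableType d1)
  (U : measurableType d2) (R : realType).
Variables (nu : {measure set T -> \bar R}) (k : R.-ker T ~> U).
Variable nu' : {measure set U -> \bar R}.
Hypothesis nu'E : forall A, measurable A -> nu' A = (\int[nu]_z k z A)%E.
Local Open Scope ereal_scope.

Import HBNNSimple.

Let sintegral_mixture (h : {nnsfun U >-> R}) :
  sintegral nu' h = \int[nu]_z sintegral (k z) h.
Proof.
under eq_integral do rewrite sintegralE.
rewrite ge0_integral_fsum//; last 2 first.
  by move=> r; apply: measurable_funeM; exact: measurable_kernel.
  by move=> n x _; exact: nnsfun_mulemu_ge0.
rewrite sintegralE /=; apply: eq_fsbigr => // r rh.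
have r0 : (0 <= r)%R by move: rh; rewrite inE => -[x _ <-].
by rewrite ge0_integralZl ?nu'E//; exact: measurable_kernel.
Qed.

Lemma measurable_kernel_integral (h : U -> \bar R) :
  measurable_fun [set: U] h -> (forall x, 0 <= h x) ->
  measurable_fun [set: T] (fun z => \int[k z]_y h y).
Proof.
move=> mh h0; apply: measurable_fun_integral_kernel => // A mA.
exact: measurable_kernel.
Qed.

(** Simple functions, then monotone convergence on both levels. The measure [nu'] is only tied to
    the mixture by its values on measurable sets, so that the result serves for [law t], for
    [law (s + t)] and, through Chapman-Kolmogorov, for [P (s + t) z]. *)
Lemma ge0_integral_mixture (h : U -> \bar R) :
  measurable_fun [set: U] h -> (forall x, 0 <= h x) ->
  \int[nu']_y h y = \int[nu]_z \int[k z]_y h y.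
Proof.
move=> mh h0.
pose g := nnsfun_approx measurableT mh.
pose gE := fun n => EFin \o g n.
have mgE n : measurable_fun [set: U] (gE n) by exact/measurable_EFinP.
have gE_ge0 n x : 0 <= gE n x by rewrite lee_fin.
have nd_gE x : {homo gE ^~ x : n m / (n <= m)%O >-> n <= m}.
  by move=> *; exact/lefP/nd_nnsfun_approx.
transitivity (limn (fun n => \int[nu']_x gE n x)).
  rewrite -monotone_convergence//; apply: eq_integral => t _.
  by apply/esym/cvg_lim => //; exact: cvg_nnsfun_approx.
transitivity (limn (fun n => \int[nu]_z \int[k z]_x gE n x)).
  apply: congr_lim; apply/funext => n.
  rewrite integralT_nnsfun sintegral_mixture; apply: eq_integral => x _.
  by rewrite integralT_nnsfun.
rewrite -[LHS]monotone_convergence//; last 3 first.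
  by move=> n; exact: measurable_kernel_integral.
  by move=> n x _; exact: integral_ge0.
  by move=> x _ m n mn; apply: ge0_le_integral => // t _; exact: nd_gE.
apply: eq_integral => mu _.
rewrite -monotone_convergence//.
apply: eq_integral => t _.
by apply/cvg_lim => //; exact: cvg_nnsfun_approx.
Qed.

Variable f : U -> R.
Hypothesis intf : nu'.-integrable setT (EFin \o f).

Let mf : measurable_fun setT (EFin \o f). Proof. exact: measurable_int intf. Qed.

(** The integral of [|f|] under [k z] is a function of [z] whose own integral is that of [|f|] under
    [nu']; being finite, it forces finiteness for almost every [z]. *)
Lemma ae_integrable_mixture :
  {ae nu, forall z, (k z).-integrable setT (EFin \o f)}.
Proof.
have mabs : measurable_fun setT (fun z => \int[k z]_y `|(f y)%:E|).
  by apply: measurable_kernel_integral => //; exact: measurableT_comp.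
have : nu.-integrable setT (fun z => \int[k z]_y `|(f y)%:E|).
  apply/integrableP; split => //.
  under eq_integral do rewrite gee0_abs ?integral_ge0//.
  rewrite -ge0_integral_mixture//; last exact: measurableT_comp.
  by case/integrableP : intf.
move/integrable_ae => /(_ measurableT); apply: filterS => x /= /(_ I) im2f.
apply/integrableP; split; first exact: mf.
by move/fin_numPlt : im2f => /andP[].
Qed.

Let integrable_part (g : U -> \bar R) : measurable_fun setT g ->
  (forall y, 0 <= g y) -> (forall y, g y <= `|(f y)%:E|) ->
  nu.-integrable setT (fun z => \int[k z]_y g y).
Proof.
move=> mg g0 gf; apply/integrableP; split; first exact: measurable_kernel_integral.
under eq_integral do rewrite gee0_abs ?integral_ge0//.
rewrite -ge0_integral_mixture//.
case/integrableP : intf => _; apply: le_lt_trans.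
by apply: ge0_le_integral => //; exact: measurableT_comp.
Qed.

Let fp := integrable_part (measurable_funepos mf) (funepos_ge0 _)
  (fun y => ltac:(by rewrite -[leRHS]/((abse \o (EFin \o f)) y) fune_abse leeDl)).
Let fn := integrable_part (measurable_funeneg mf) (funeneg_ge0 _)
  (fun y => ltac:(by rewrite -[leRHS]/((abse \o (EFin \o f)) y) fune_abse leeDr)).

Let intE z : \int[k z]_y (f y)%:E =
  \int[k z]_y (EFin \o f)^\+ y - \int[k z]_y (EFin \o f)^\- y.
Proof. by rewrite integralE. Qed.

Let measurable_int_mixture : measurable_fun setT (fun z => \int[k z]_y (f y)%:E).
Proof.
under eq_fun do rewrite intE.
by apply: emeasurable_funB; [case/integrableP : fp|case/integrableP : fn].
Qed.

Lemma measurable_Rintegral_mixture :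
  measurable_fun setT (fun z => (\int[k z]_y f y)%R).
Proof. exact: measurableT_comp. Qed.

Lemma integral_mixture :
  \int[nu]_z (\int[k z]_y f y)%R%:E = \int[nu']_y (f y)%:E.
Proof.
(* The real-valued and the extended inner integrals differ only where [f] is not integrable under
   [k z], which is a [nu]-null set of [z]. *)
transitivity (\int[nu]_z \int[k z]_y (f y)%:E).
  apply: ae_eq_integral => //.
    by apply/measurable_EFinP; exact: measurable_Rintegral_mixture.
  have := ae_integrable_mixture; apply: filterS => z iz _.
  by rewrite /Rintegral fineK//; exact: integrable_fin_num.
under eq_integral do rewrite intE.
rewrite integralB//.
rewrite [RHS]integralE; congr (_ - _); rewrite ge0_integral_mixture//.
  exact: measurable_funepos.
exact: measurable_funeneg.
Qed.

Lemma Rintegral_mixture :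
  (\int[nu]_z (\int[k z]_y f y) = \int[nu']_y f y)%R.
Proof. by rewrite [LHS]/Rintegral integral_mixture. Qed.

End mixture_integral.

(** * The L^2 norm of a probability measure *)

Section L2_space.
Context (d : measure_display) (T : measurableType d) (R : realType).
Variable m : probability T R.
Implicit Types f g : T -> R.

Lemma norm2E f : norm2 m f = sqrte (\int[m]_x (f x ^+ 2)%:E)%E.
Proof.
rewrite /norm2 unlock poweR12_sqrt; last first.
  by apply: integral_ge0 => x _; exact: poweR_ge0.
congr sqrte; apply: eq_integral => x _ /=.
by rewrite powR_mulrn// -normrX ger0_norm// sqr_ge0.
Qed.

Lemma norm2_ge0 f : (0 <= norm2 m f)%E. Proof. exact: Lnorm_ge0. Qed.

Lemma le_norm2 f g : measurable_fun setT f -> measurable_fun setT g ->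
  (forall x, `|f x| <= `|g x|) -> (norm2 m f <= norm2 m g)%E.
Proof.
move=> mf mg fg; rewrite !norm2E lee_sqrt; last first.
  by apply: integral_ge0 => x _; rewrite lee_fin sqr_ge0.
apply: ge0_le_integral => //.
- by move=> x _; rewrite lee_fin sqr_ge0.
- by apply/measurable_EFinP; exact: measurable_funX.
- by apply/measurable_EFinP; exact: measurable_funX.
- move=> x _; rewrite lee_fin -[leLHS]ger0_norm ?sqr_ge0//.
  by rewrite -[leRHS]ger0_norm ?sqr_ge0// !normrX ler_sqr ?nnegrE.
Qed.

Lemma ae_eq_norm2 f g : measurable_fun setT f -> measurable_fun setT g ->
  {ae m, forall x, f x = g x} -> norm2 m f = norm2 m g.
Proof.
move=> mf mg fg; rewrite !norm2E; congr sqrte; apply: ae_eq_integral => //.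
- by apply/measurable_EFinP; exact: measurable_funX.
- by apply/measurable_EFinP; exact: measurable_funX.
- by apply: filterS fg => x ->.
Qed.

Lemma norm2Z (a : R) f : measurable_fun setT f ->
  norm2 m (fun x => a * f x) = (`|a|%:E * norm2 m f)%E.
Proof.
move=> mf; rewrite !norm2E.
under eq_integral do rewrite exprMn EFinM.
rewrite ge0_integralZl//; last 3 first.
- by apply/measurable_EFinP; exact: measurable_funX.
- by move=> x _; rewrite lee_fin sqr_ge0.
- by rewrite lee_fin sqr_ge0.
rewrite sqrteM ?lee_fin ?sqr_ge0//; congr (_ * _)%E.
by rewrite /= sqrtr_sqr.
Qed.

Lemma L2P f : f \in L2 m <->
  measurable_fun setT f /\ (norm2 m f < +oo)%E.
Proof.
split.
  by rewrite inE => /andP[]; rewrite !inE.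
by move=> [mf nf]; rewrite inE; apply/andP; split; rewrite inE.
Qed.

Lemma L2_measurable f : f \in L2 m -> measurable_fun setT f.
Proof. by case/L2P. Qed.

Lemma norm2_fin_num f : f \in L2 m -> norm2 m f \is a fin_num.
Proof. by case/L2P => _ nf; rewrite ge0_fin_numE// norm2_ge0. Qed.

Lemma L2_integrable f : f \in L2 m -> m.-integrable setT (EFin \o f).
Proof.
move=> f2; apply/Lfun1_integrable.
have mT : m setT \is a fin_num by rewrite probability_setT.
exact: (Lfun_subset12 mT f2).
Qed.

Lemma le_L2 f g : measurable_fun setT f -> g \in L2 m ->
  (forall x, `|f x| <= `|g x|) -> f \in L2 m.
Proof.
move=> mf /L2P[mg ng] fg; apply/L2P; split => //.
by apply: le_lt_trans ng; exact: le_norm2.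
Qed.

Lemma L2Z (a : R) f : f \in L2 m -> (fun x => a * f x) \in L2 m.
Proof.
move=> /[dup] f2 /L2P[mf nf]; apply/L2P; split; first exact: measurable_funM.
rewrite norm2Z//; apply: lte_mul_pinfty => //.
Qed.

Lemma L2D f g : f \in L2 m -> g \in L2 m -> (fun x => f x + g x) \in L2 m.
Proof.
move=> /L2P[mf nf] /L2P[mg ng]; apply/L2P; split; first exact: measurable_funD.
apply: (le_lt_trans (minkowski_EFin m mf mg _)); first by rewrite ler1n.
by rewrite lte_add_pinfty.
Qed.

Lemma L2B f g : f \in L2 m -> g \in L2 m -> (fun x => f x - g x) \in L2 m.
Proof.
move=> f2 g2; have := L2D f2 (L2Z (-1) g2).
by under [fun x => _ + _]eq_fun do rewrite mulN1r.
Qed.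

Lemma integral_abs_le_norm2 f : measurable_fun setT f ->
  (\int[m]_x `|f x|%:E <= norm2 m f)%E.
Proof.
(* Cauchy-Schwarz against the constant 1, whose norm is 1 because [m] is a probability. *)
move=> mf; have := @hoelder _ _ _ m f (cst 1) 2 2 mf (measurable_cst _).
rewrite ltr0n => /(_ isT isT).
have -> : (2^-1 + 2^-1 = 1 :> R) by rewrite [RHS]splitr !div1r.
move=> /(_ erefl); rewrite Lnorm1 Lnorm_cst1.
have -> : (m : {measure set T -> \bar R}) setT = 1%E by exact: probability_setT.
rewrite poweR1r mule1.
by under eq_integral do rewrite /= mulr1.
Qed.

Lemma normr_Rintegral_le_norm2 f : f \in L2 m ->
  `| \int[m]_x f x | <= fine (norm2 m f).
Proof.
move=> f2; rewrite -lee_fin fineK ?norm2_fin_num//.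
apply: le_trans (integral_abs_le_norm2 (L2_measurable f2)).
rewrite EFin_normr_Rintegral//; last exact: L2_integrable.
apply: le_abse_integral => //; apply/measurable_EFinP; exact: L2_measurable.
Qed.

End L2_space.

(** * Laws of a Markov semigroup *)

Section law.
Context (disp : measure_display) (T : measurableType disp) (R : realType).
Variables (m : probability T R) (P : R -> R.-pker T ~> T).

Definition law (t : R) : {measure set T -> \bar R} := mixture m (P t).

Lemma law_setT t : law t setT = 1%E.
Proof.
transitivity (\int[m]__ (1%E : \bar R))%E; last first.
  by rewrite integral_cst// mul1e; exact: probability_setT.
by apply: eq_integral => z _; rewrite prob_kernel.
Qed.

Lemma lawE t A : measurable A -> law t A = (\int[m]_z P t z A)%E.
Proof. by []. Qed.

Hypotheses (Ptr : transition_function P) (PC0 : C0_semigroup m P).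

Lemma law0 A : measurable A -> law 0 A = m A.
Proof.
move=> mA; rewrite lawE//; under eq_integral do rewrite (proj1 Ptr)// diracE.
have -> : m A = (\int[m]_z (\1_A z)%:E)%E by rewrite integral_indic// setIT.
by apply: eq_integral => z _; rewrite indicE.
Qed.

Lemma lawD s t A : 0 <= s -> 0 <= t -> measurable A ->
  law (s + t) A = (\int[law s]_z P t z A)%E.
Proof.
move=> s0 t0 mA; rewrite lawE//.
transitivity (\int[m]_z \int[P s z]_y P t y A)%E.
  by apply: eq_integral => z _; exact: (proj2 Ptr).
rewrite (ge0_integral_mixture (nu := m) (k := P s))//.
exact: measurable_kernel.
Qed.

(** For a bounded nonnegative [g], the integral under [law t] is the [m]-integral of [kact P t g],
    at most its L^2 norm. The truncations [min(|f|, n)] reduce the general case to this one: for [f]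
    itself [kact] has no meaning before integrability is known, and integrability is what the bound
    is meant to provide. *)
Lemma law_L2_bound t : 0 <= t -> exists2 M : R, 0 <= M &
  forall f, f \in L2 m -> (\int[law t]_z `|f z|%:E <= M%:E * norm2 m f)%E.
Proof.
move=> t0; have [M PM] := proj1 PC0 t t0.
(* The bound in [C0_semigroup] carries no sign; the maximum with 0 makes it a nonnegative factor. *)
exists (Num.max M 0); first by rewrite le_max lexx orbT.
move=> f f2; have mf := L2_measurable f2.
pose g n z := Num.min `|f z| n%:R.
have mg n : measurable_fun setT (g n).
  by apply: measurable_minr => //; exact: measurableT_comp.
have g0 n z : 0 <= g n z by rewrite le_min normr_ge0 ler0n.
have gf n z : `|g n z| <= `|f z| by rewrite ger0_norm// ge_min lexx.
have g2 n : g n \in L2 m by exact: le_L2 f2 _.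
have nd z : {homo (fun n => (g n z)%:E) : a b / (a <= b)%N >-> (a <= b)%E}.
  move=> a b ab; rewrite lee_fin /g le_min ge_min lexx/=.
  by rewrite ge_min ler_nat ab orbT.
have key n : (\int[law t]_z (g n z)%:E <= (Num.max M 0)%:E * norm2 m f)%E.
  have -> : (\int[law t]_z (g n z)%:E = \int[m]_z `|kact P t (g n) z|%:E)%E.
    rewrite (ge0_integral_mixture (nu := m) (k := P t))//; last 2 first.
    - by apply/measurable_EFinP.
    - by move=> z; rewrite lee_fin.
    apply: eq_integral => z _; rewrite ger0_norm ?Rintegral_ge0//.
    rewrite /kact /Rintegral fineK//; apply: integrable_fin_num => //.
    apply: measurable_bounded_integrable => //.
      by rewrite prob_kernel ltry.
    exists n%:R; split; first exact: num_real.
    move=> x nx y _ /=; rewrite ger0_norm// ge_min (ltW nx) orbT//.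
  have [Pg2 Pgn] := PM _ (g2 n).
  apply: (le_trans (integral_abs_le_norm2 m (L2_measurable Pg2))).
  apply: (le_trans Pgn).
  apply: (@le_trans _ _ ((Num.max M 0)%:E * norm2 m (g n))%E).
    by apply: lee_wpmul2r; rewrite ?norm2_ge0// lee_fin le_max lexx.
  apply: lee_wpmul2l; first by rewrite lee_fin le_max lexx orbT.
  exact: le_norm2.
have -> : (\int[law t]_z `|f z|%:E = limn (fun n => \int[law t]_z (g n z)%:E))%E.
  rewrite -monotone_convergence//; last 2 first.
  - by move=> n; apply/measurable_EFinP.
  - by move=> n z _; rewrite lee_fin.
  apply: eq_integral => z _; apply/esym/cvg_lim => //.
  have /archi_boundP /ltW fN := normr_ge0 (f z).
  apply: cvg_near_cst; exists (Num.bound `|f z|) => // n /= Nn; rewrite /g min_l//.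
  by rewrite (le_trans fN)// ler_nat.
apply: lime_le; last by near=> n; exact: key.
apply: ereal_nondecreasing_is_cvgn => a b ab; apply: ge0_le_integral => //.
- by move=> z _; rewrite lee_fin.
- by apply/measurable_EFinP.
- by apply/measurable_EFinP.
- by move=> z _; exact: nd.
Unshelve. all: by end_near. Qed.

Lemma L2_integrable_law t f : 0 <= t -> f \in L2 m ->
  (law t).-integrable setT (EFin \o f).
Proof.
move=> t0 f2; have [M M0 Mf] := law_L2_bound t0.
apply/integrableP; split; first by apply/measurable_EFinP; exact: L2_measurable f2.
apply: (le_lt_trans (Mf f f2)).
by rewrite -(fineK (norm2_fin_num f2)) -EFinM ltry.
Qed.

Lemma L2_ae_integrable_kernel t f : 0 <= t -> f \in L2 m ->
  {ae m, forall z, (P t z).-integrable setT (EFin \o f)}.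
Proof.
move=> t0 f2.
exact: (ae_integrable_mixture (lawE t) (L2_integrable_law t0 f2)).
Qed.

Lemma kact_L2 t f : 0 <= t -> f \in L2 m -> kact P t f \in L2 m.
Proof. by move=> t0 f2; have [M PM] := proj1 PC0 t t0; case: (PM _ f2). Qed.

Lemma Rintegral_kact t f : 0 <= t -> f \in L2 m ->
  \int[m]_z kact P t f z = \int[law t]_z f z.
Proof.
move=> t0 f2.
exact: (Rintegral_mixture (lawE t) (L2_integrable_law t0 f2)).
Qed.

Lemma Rintegral_law_kact s t f : 0 <= s -> 0 <= t -> f \in L2 m ->
  \int[law s]_z kact P t f z = \int[law (s + t)]_z f z.
Proof.
move=> s0 t0 f2.
have E A : measurable A -> law (s + t) A = (\int[law s]_z P t z A)%E.
  exact: lawD.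
apply: (Rintegral_mixture E); exact: L2_integrable_law (addr_ge0 s0 t0) f2.
Qed.

(** Chapman-Kolmogorov passes from sets to [f] at every starting point [z] for which [f] is
    integrable under [P (s + t) z], hence at almost every [z]. *)
Lemma kactD s t f : 0 <= s -> 0 <= t -> f \in L2 m ->
  {ae m, forall z, kact P s (kact P t f) z = kact P (s + t) f z}.
Proof.
move=> s0 t0 f2.
have := L2_ae_integrable_kernel (addr_ge0 s0 t0) f2; apply: filterS => z iz.
have E A : measurable A -> P (s + t) z A = (\int[P s z]_y P t y A)%E.
  by move=> mA; rewrite (proj2 Ptr).
exact: (Rintegral_mixture E).
Qed.

End law.

Lemma cvge0_at_right0P (R : realType) (F : R -> \bar R) :
  (forall t, 0 <= F t)%E ->
  (F t @[t --> 0^'+] --> 0%E) <->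
  (forall e : R, 0 < e -> exists2 h : R, 0 < h &
     forall t, 0 < t -> t < h -> (F t < e%:E)%E).
Proof.
move=> F0; split=> [/fine_cvgP[Ffin /cvgrPdist_lt FF] e e0|FF].
  have [h /= h0 hF] : \forall t \near 0^'+, (F t < e%:E)%E.
    near=> t.
    have tfin : F t \is a fin_num by near: t.
    rewrite -(fineK tfin) lte_fin -[ltLHS]ger0_norm ?fine_ge0//.
    rewrite -normrN -sub0r.
    by near: t; exact: FF.
  exists h => // t t0 th; apply: hF => //=.
  by rewrite sub0r normrN gtr0_norm.
apply/fine_cvgP; split.
  have [h h0 hF] := FF 1 ltr01.
  exists h => //= t /=; rewrite /ball_ /= sub0r normrN => th t0.
  rewrite ge0_fin_numE// (lt_trans (hF t t0 _)) ?ltry//.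
  by rewrite (le_lt_trans _ th)// ler_norm.
apply/cvgrPdist_lt => e e0; have [h h0 hF] := FF e e0.
exists h => //= t /=; rewrite /ball_ /= sub0r normrN => th t0.
have Fe : (F t < e%:E)%E by apply: hF => //; rewrite (le_lt_trans _ th)// ler_norm.
rewrite sub0r normrN ger0_norm ?fine_ge0//.
by rewrite -lte_fin fineK// ge0_fin_numE// (lt_trans Fe) ?ltry.
Unshelve. all: by end_near. Qed.

(** * Difference quotients of the semigroup *)

Section generator.
Context (disp : measure_display) (T : measurableType disp) (R : realType).
Variables (m : probability T R) (P : R -> R.-pker T ~> T).
Hypotheses (Ptr : transition_function P) (PC0 : C0_semigroup m P).
Local Notation law := (law m P).

Lemma Rintegral_law0 f : \int[law 0]_z f z = \int[m]_z f z.
Proof.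
by congr fine; apply: eq_measure_integral => A mA _; exact: (law0 m Ptr).
Qed.

Lemma normr_Rintegral_law_le t f M : 0 <= t -> f \in L2 m ->
  (\int[law t]_z `|f z|%:E <= M%:E * norm2 m f)%E ->
  `|\int[law t]_z f z| <= M * fine (norm2 m f).
Proof.
move=> t0 f2 fM; have intf := L2_integrable_law PC0 t0 f2.
rewrite -lee_fin EFinM fineK ?norm2_fin_num//.
apply: le_trans fM; rewrite EFin_normr_Rintegral//.
apply: le_abse_integral => //; apply/measurable_EFinP; exact: L2_measurable f2.
Qed.

(** The inequality is known up to an [m]-null set, whereas the integrals are taken under [law t].
    The positive part of [f - g] has zero L^2(m) norm, so the L^2 bound on the law makes its
    integral under [law t] vanish. *)
Lemma ae_le_Rintegral_law t f g : 0 <= t -> f \in L2 m -> g \in L2 m ->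
  {ae m, forall z, f z <= g z} -> \int[law t]_z f z <= \int[law t]_z g z.
Proof.
move=> t0 f2 g2 fg.
pose h z := Num.max (f z - g z) 0.
have mh : measurable_fun setT h.
  apply: measurable_maxr => //.
  by apply: measurable_funB; [exact: L2_measurable f2|exact: L2_measurable g2].
have h2 : h \in L2 m.
  apply: le_L2 (L2B f2 g2) _ => // z.
  rewrite /h; case: (leP (f z - g z) 0) => _ //.
  by rewrite normr0.
have h0 : norm2 m h = 0%E.
  rewrite (@ae_eq_norm2 _ _ _ m h (cst 0))//.
    rewrite norm2E (eq_integral (cst 0%E)) ?integral0 ?sqrte0// => z _.
    by rewrite expr0n.
  apply: filterS fg => z fgz; rewrite /h /= max_r// subr_le0//.
have [M M0 PM] := law_L2_bound PC0 t0.
have := normr_Rintegral_law_le t0 h2 (PM h h2).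
rewrite h0 mulr0 normr_le0 => /eqP hz.
have -> : \int[law t]_z g z = \int[law t]_z (g z + h z).
  by rewrite RintegralD// ?hz ?addr0//; exact: L2_integrable_law.
apply: le_Rintegral => //; first exact: L2_integrable_law.
  by apply: L2_integrable_law => //; exact: L2D.
by move=> z _; rewrite -lerBlDl le_max lexx.
Qed.

Lemma generates_Rintegral f g h : 0 < h -> generates m P f g ->
  `| h^-1 * (\int[law h]_z f z - \int[m]_z f z) - \int[m]_z g z | <=
  fine (norm2 m (fun z => h^-1 * (kact P h f z - f z) - g z)).
Proof.
move=> h0 [f2 g2 _].
have Pf2 := kact_L2 PC0 (ltW h0) f2.
have d2 := L2B Pf2 f2.
apply: le_trans (normr_Rintegral_le_norm2 (L2B (L2Z h^-1 d2) g2)).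
rewrite RintegralB//; [|exact: L2_integrable (L2Z _ d2)|exact: L2_integrable].
rewrite RintegralZl//; last exact: L2_integrable d2.
rewrite RintegralB//; [|exact: L2_integrable|exact: L2_integrable].
by rewrite Rintegral_kact// ltW.
Qed.

Lemma generatesP f g e : generates m P f g -> 0 < e ->
  exists2 h : R, 0 < h & forall t, 0 < t -> t < h ->
    fine (norm2 m (fun z => t^-1 * (kact P t f z - f z) - g z)) < e.
Proof.
move=> [f2 g2 fg] e0.
have [h h0 H] := (cvge0_at_right0P (fun t => norm2_ge0 m _)).1 fg e e0.
exists h => // t t0 th; have := H t t0 th.
rewrite -[X in (X < _)%E]fineK; first by rewrite lte_fin.
apply: norm2_fin_num; apply: L2B => //; apply/L2Z/L2B => //.
exact: (kact_L2 PC0 (ltW t0)).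
Qed.

(** Both integrals are limits of the same quotients. This is what identifies the integrals of
    [P_s (L f)] and of [L (P_s f)], two candidates for the image of [P_s f] under the generator. *)
Lemma generates_unique_Rintegral f g g' :
  generates m P f g -> generates m P f g' -> \int[m]_z g z = \int[m]_z g' z.
Proof.
move=> fg fg'; apply/eqP; rewrite -subr_eq0 -normr_le0.
apply/ler_addgt0Pl => e e0; rewrite addr0.
have e20 : 0 < e / 2 by rewrite divr_gt0.
have [h h0 H] := generatesP fg e20; have [h' h'0 H'] := generatesP fg' e20.
pose t := Num.min h h' / 2.
have hh : 0 < Num.min h h' by rewrite lt_min h0.
have t0 : 0 < t by rewrite divr_gt0.
have th : t < Num.min h h' by rewrite ltr_pdivrMr// ltr_pMr// ltr1n.
move: (th); rewrite lt_min => /andP[th1 th2].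
have I1 := le_lt_trans (generates_Rintegral t0 fg) (H t t0 th1).
have I2 := le_lt_trans (generates_Rintegral t0 fg') (H' t t0 th2).
rewrite [e]splitr; apply/ltW.
rewrite distrC in I1.
apply: le_lt_trans (ltrD I1 I2); apply: le_trans (ler_normD _ _).
by rewrite addrA subrK.
Qed.

(** [P_s] commutes with the difference quotients and is bounded on L^2(m), so it carries the
    convergence for [f] over to [P_s f]. *)
Lemma kact_generates s f g : 0 <= s -> generates m P f g ->
  generates m P (kact P s f) (kact P s g).
Proof.
move=> s0 [f2 g2 fg]; have Pf2 := kact_L2 PC0 s0 f2.
have Pg2 := kact_L2 PC0 s0 g2; split => //.
apply/cvge0_at_right0P => [t|e e0]; first exact: norm2_ge0.
have [M PM] := proj1 PC0 s s0.
(* The added 1 makes [N] positive, so that [e / N] is a valid tolerance. *)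
pose N := Num.max M 0 + 1.
have N0 : 0 < N by rewrite ltr_wpDl// le_max lexx orbT.
have [|h h0 H] := (cvge0_at_right0P (fun t => norm2_ge0 m _)).1 fg (e / N).
  exact: divr_gt0.
exists h => // t t0 th.
have t0' := ltW t0.
have Ptf2 := kact_L2 PC0 t0' f2.
have w2 : (fun z => t^-1 * (kact P t f z - f z) - g z) \in L2 m.
  by apply: L2B => //; exact/L2Z/L2B.
have [Pw2 Pwn] := PM _ w2.
(* The quotient of [P_s f] and the image under [P_s] of the quotient of [f] are compared almost
   everywhere: the starting point must integrate [f], [g] and [P_t f] under [P s z], and satisfy the
   semigroup law in both orders. *)
rewrite (@ae_eq_norm2 _ _ _ m _
  (kact P s (fun z => t^-1 * (kact P t f z - f z) - g z))).
- apply: (le_lt_trans Pwn).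
  have nw := H t t0 th.
  have nf := norm2_fin_num w2.
  move: nw; rewrite -(fineK nf) -EFinM !lte_fin ltr_pdivlMr// => nw.
  apply: le_lt_trans nw; rewrite mulrC ler_wpM2l ?fine_ge0 ?norm2_ge0//.
  by rewrite ler_wpDr// le_max lexx.
- apply: L2_measurable; apply: (L2B _ Pg2); apply: L2Z; apply: L2B => //.
  exact: kact_L2 Pf2.
- exact: L2_measurable Pw2.
have i1 := L2_ae_integrable_kernel PC0 s0 f2.
have i2 := L2_ae_integrable_kernel PC0 s0 g2.
have i3 := L2_ae_integrable_kernel PC0 s0 Ptf2.
have e1 := kactD Ptr PC0 t0' s0 f2.
have e2 := kactD Ptr PC0 s0 t0' f2.
near=> z.
have -> : kact P t (kact P s f) z = kact P s (kact P t f) z.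
  by rewrite (near e1 z)// (near e2 z)// addrC.
have j1 := near i1 z; have j2 := near i2 z; have j3 := near i3 z.
have jd : (P s z).-integrable setT (EFin \o (fun y => kact P t f y - f y)).
  by apply: (@integrableB _ _ _ _ setT measurableT (EFin \o kact P t f)
    (EFin \o f)); [exact: j3|exact: j1].
rewrite [in RHS]/kact RintegralB//.
- rewrite RintegralZl// RintegralB//; [exact: j3|exact: j1].
- exact: (integrableZl measurableT t^-1 jd).
- exact: j2.
Unshelve. all: by end_near. Qed.

End generator.

(** * Uniform bounds on the laws for small times, and invariance *)

Section invariance.
Context (disp : measure_display) (T : measurableType disp) (R : realType).
Variables (m : probability T R) (P : R -> R.-pker T ~> T).
Hypotheses (Ptr : transition_function P) (PC0 : C0_semigroup m P).
Local Notation law := (law m P).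

(** The dominating function is the square root of the sum of the squares [u n ^ 2], whose integral
    is at most a geometric series. The domination fails at most where this sum is infinite, a null
    set on which [fine] returns 0. *)
Lemma square_summable_dominated (u : nat -> T -> R) :
  (forall n, measurable_fun setT (u n)) -> (forall n z, 0 <= u n z) ->
  (forall n, norm2 m (u n) <= (1 / (2 ^ (n + 1))%:R)%:E)%E ->
  exists2 f, f \in L2 m & forall n, {ae m, forall z, u n z <= f z}.
Proof.
move=> mu u0 nu.
pose W z : \bar R := (\sum_(0 <= n <oo) (u n z ^+ 2)%:E)%E.
have W0 z : (0 <= W z)%E.
  by apply: nneseries_ge0 => n _ _; rewrite lee_fin sqr_ge0.
have mW : measurable_fun setT W.
  apply: ge0_emeasurable_sum => [n z _ _|n _]; first by rewrite lee_fin sqr_ge0.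
  by apply/measurable_EFinP; exact: measurable_funX.
have iu n : (\int[m]_z (u n z ^+ 2)%:E <= (1 / (2 ^ (n + 1))%:R)%:E)%E.
  have I0 : (0 <= \int[m]_z (u n z ^+ 2)%:E)%E.
    by apply: integral_ge0 => z _; rewrite lee_fin sqr_ge0.
  have e1 : 1 / (2 ^ (n + 1))%:R <= 1 :> R.
    by rewrite ler_pdivrMr ?mul1r ?ler1n ?ltr0n expn_gt0.
  have e0 : 0 <= 1 / (2 ^ (n + 1))%:R :> R by rewrite divr_ge0.
  have := nu n; rewrite norm2E => nun.
  rewrite -(sqr_sqrte I0) expe2.
  (* One factor of the squared norm keeps the bound [2^-(n+1)], the other is bounded by 1. *)
  apply: (@le_trans _ _ ((1 / (2 ^ (n + 1))%:R)%:E * 1%:E)%E).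
    apply: lee_pmul => //; try exact: sqrte_ge0.
    by apply: (le_trans nun); rewrite lee_fin.
  by rewrite mule1.
have iW : (\int[m]_z W z < +oo)%E.
  rewrite integral_nneseries//; last 2 first.
  - by move=> n; apply/measurable_EFinP; exact: measurable_funX.
  - by move=> n z _; rewrite lee_fin sqr_ge0.
  apply: (@le_lt_trans _ _ (\sum_(0 <= n <oo) (1 / (2 ^ (n + 1))%:R)%:E)%E).
    apply: lee_nneseries => // n _ _; apply: integral_ge0 => z _.
    by rewrite lee_fin sqr_ge0.
  have := @cvg_geometric_eseries_half R 1 0.
  by move=> /cvg_lim ->//; rewrite ltry.
pose f z := Num.sqrt (fine (W z)).
have mf : measurable_fun setT f.
  apply: (measurableT_comp (f := @Num.sqrt R)).
    by apply: continuous_measurable_fun; exact: sqrt_continuous.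
  exact: measurableT_comp.
exists f.
  apply/L2P; split => //; rewrite norm2E.
  have I0 : (0 <= \int[m]_z (f z ^+ 2)%:E)%E.
    by apply: integral_ge0 => z _; rewrite lee_fin sqr_ge0.
  rewrite -ge0_fin_numE ?sqrte_ge0// sqrte_fin_num// ge0_fin_numE//.
  apply: le_lt_trans iW; apply: ge0_le_integral => //.
  - by move=> z _; rewrite lee_fin sqr_ge0.
  - by apply/measurable_EFinP; exact: measurable_funX.
  - move=> z _; rewrite /f sqr_sqrtr ?fine_ge0//.
    have := W0 z; case: (W z) => [r| |] //=; by rewrite leey.
move=> n.
have iWW : m.-integrable setT W.
  apply/integrableP; split => //.
  by under eq_integral do rewrite gee0_abs//.
have := integrable_ae measurableT iWW; apply: filterS => z /(_ I) Wz.
rewrite -(ler_sqr (u0 n z)) ?nnegrE ?sqrtr_ge0// sqr_sqrtr ?fine_ge0//.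
rewrite -lee_fin fineK//.
have le1 : (\sum_(0 <= i < n.+1) (u i z ^+ 2)%:E <= W z)%E.
  by apply: nneseries_lim_ge => k _ _; rewrite lee_fin sqr_ge0.
apply: le_trans le1; rewrite big_nat_recr//= leeDr// sume_ge0// => k _.
by rewrite lee_fin sqr_ge0.
Qed.

(* Gliding hump.  The kernels are positive, so a function dominating all the
   humps inherits the blow-up of each of them: no Baire category is needed. *)
Lemma law_L2_locally_bounded : exists2 h : R, 0 < h &
  exists2 K : R, 0 <= K & forall s, 0 <= s -> s <= h -> forall f, f \in L2 m ->
  (\int[law s]_z `|f z|%:E <= K%:E * norm2 m f)%E.
Proof.
apply: contrapT => nobound.
(* The negation of the claim at radius [1/(n+1)] with constant [n * 2^(n+1)]. Once the hump is
   rescaled to norm at most [2^-(n+1)], the powers of two cancel and its integral under the law at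
   time [s n] is at least [n]. *)
have hump n : exists sg : R * (T -> R), [/\ 0 <= sg.1, sg.1 <= n.+1%:R^-1,
    sg.2 \in L2 m & ((n%:R * (2 ^ (n + 1))%:R)%:E * norm2 m sg.2 <
       \int[law sg.1]_z `|sg.2 z|%:E)%E].
  apply: contrapT => nohump; apply: nobound.
  exists (n.+1%:R^-1); first by rewrite invr_gt0.
  exists (n%:R * (2 ^ (n + 1))%:R); first by rewrite mulr_ge0.
  move=> s s0 sn f f2; rewrite leNgt; apply/negP => lt.
  by apply: nohump; exists (s, f).
have {hump} [sg sgP] := choice hump.
pose s n := (sg n).1; pose g n := (sg n).2.
have s0 n : 0 <= s n by case: (sgP n).
have sn n : s n <= n.+1%:R^-1 by case: (sgP n).
have g2 n : g n \in L2 m by case: (sgP n).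
pose N n := fine (norm2 m (g n)).
have NE n : norm2 m (g n) = (N n)%:E by rewrite fineK// norm2_fin_num.
have gN n : ((n%:R * (2 ^ (n + 1))%:R)%:E * (N n)%:E <
    \int[law (s n)]_z `|g n z|%:E)%E by rewrite -NE; case: (sgP n).
have N0 n : 0 < N n.
  rewrite lt_neqAle fine_ge0 ?norm2_ge0// andbT; apply/negP => /eqP N0.
  have [M M0 PM] := law_L2_bound PC0 (s0 n).
  have := lt_le_trans (gN n) (PM _ (g2 n)).
  by rewrite NE -N0 !mule0 ltxx.
pose c n := (1 / (2 ^ (n + 1))%:R) / N n.
have c0 n : 0 <= c n by rewrite /c !divr_ge0// ltW.
pose u n z := c n * `|g n z|.
have mg n : measurable_fun setT (fun z => `|g n z|).
  by apply: measurableT_comp => //; exact: L2_measurable (g2 n).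
have mu n : measurable_fun setT (u n) by exact: measurable_funM.
have u0 n z : 0 <= u n z by rewrite mulr_ge0.
have nu n : (norm2 m (u n) <= (1 / (2 ^ (n + 1))%:R)%:E)%E.
  rewrite norm2Z// ger0_norm//.
  apply: (@le_trans _ _ ((c n)%:E * norm2 m (g n))%E).
    apply: lee_wpmul2l; first by rewrite lee_fin.
    apply: le_norm2 => //; first exact: L2_measurable (g2 n).
    by move=> z; rewrite normr_id.
  by rewrite NE -EFinM lee_fin /c divfK// gt_eqF.
have [f f2 uf] := square_summable_dominated mu u0 nu.
have u2 n : u n \in L2 m.
  by apply/L2P; split => //; apply: (le_lt_trans (nu n)); rewrite ltry.
have un n : n%:R <= \int[law (s n)]_z f z.
  apply: le_trans (ae_le_Rintegral_law PC0 (s0 n) (u2 n) f2 (uf n)).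
  rewrite -lee_fin /Rintegral fineK; last first.
    exact: (integrable_fin_num measurableT (L2_integrable_law PC0 (s0 n) (u2 n))).
  rewrite /u; under eq_integral do rewrite EFinM.
  rewrite ge0_integralZl//; [|exact/measurable_EFinP|by rewrite lee_fin].
  apply: (@le_trans _ _ ((c n)%:E * ((n%:R * (2 ^ (n + 1))%:R)%:E * (N n)%:E))%E).
    rewrite -!EFinM lee_fin /c.
    have p0 : (2 ^ (n + 1))%:R != 0 :> R by rewrite pnatr_eq0 expn_eq0.
    have q0 : N n != 0 by rewrite gt_eqF.
    by rewrite le_eqVlt; apply/orP; left; apply/eqP; field; rewrite p0 q0.
  by apply: lee_wpmul2l; [rewrite lee_fin|exact: ltW].
(* Strong continuity at 0, applied to the single dominating function [f], bounds its integral under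
   [law t] by that under [m] plus 1 for all small [t]. This contradicts [un], since [s n] tends to
   0. *)
have [h h0 H] := (cvge0_at_right0P (fun t => norm2_ge0 m _)).1
  (proj2 PC0 f f2) 1 ltr01.
have fs t : 0 <= t -> t < h -> \int[law t]_z f z <= \int[m]_z f z + 1.
  rewrite le_eqVlt => /predU1P[<- _|t0 th].
    by rewrite (Rintegral_law0 m Ptr) lerDl.
  have Pf2 := kact_L2 PC0 (ltW t0) f2.
  rewrite -lerBlDl -Rintegral_kact//; last exact: ltW.
  rewrite -RintegralB//; [|exact: L2_integrable|exact: L2_integrable].
  apply: (le_trans (ler_norm _)).
  apply: (le_trans (normr_Rintegral_le_norm2 (L2B Pf2 f2))).
  rewrite -lee_fin fineK; first exact/ltW/H.
  by apply: norm2_fin_num; exact: L2B.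
have [n nh nf] : exists2 n : nat, n.+1%:R^-1 < h & \int[m]_z f z + 1 < n%:R.
  have [n1 _ n1P] := near_infty_natSinv_lt (PosNum h0).
  exists (maxn n1 (Num.bound `|\int[m]_z f z + 1|)).
    by apply: n1P => /=; exact: leq_maxl.
  apply: (le_lt_trans (ler_norm _)).
  apply: (lt_le_trans (archi_boundP (normr_ge0 _))).
  by rewrite ler_nat leq_maxr.
have := lt_le_trans nf (un n).
by rewrite ltNge fs// (le_lt_trans (sn n)).
Qed.

Variables (D : set (T -> R)) (L : (T -> R) -> T -> R).
Hypothesis DE : D = [set f | exists g, generates m P f g].
Hypothesis DL : forall f, D f -> generates m P f (L f).

Lemma invariant_generator_Rintegral f :
  invariant_measure m P -> D f -> \int[m]_z L f z = 0.
Proof.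
move=> inv Df; have fL := DL Df; apply/eqP; rewrite -normr_le0.
apply/ler_addgt0Pl => e e0; rewrite addr0; apply/ltW.
have [h h0 H] := generatesP PC0 fL e0.
have h20 : 0 < h / 2 by rewrite divr_gt0.
have h2h : h / 2 < h by rewrite ltr_pdivrMr// ltr_pMr// ltr1n.
have := le_lt_trans (generates_Rintegral PC0 h20 fL) (H _ h20 h2h).
have -> : \int[law (h / 2)]_z f z = \int[m]_z f z.
  congr fine; apply: eq_measure_integral => A mA _.
  by rewrite lawE// inv// ltW.
by rewrite subrr mulr0 sub0r normrN.
Qed.

Lemma core_generator_Rintegral C :
  is_core m D L C -> (forall f, C f -> \int[m]_z L f z = 0) ->
  forall f, D f -> \int[m]_z L f z = 0.
Proof.
move=> [CD Capprox] C0 f Df; apply/eqP; rewrite -normr_le0.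
apply/ler_addgt0Pl => e e0; rewrite addr0; apply/ltW.
have [g Cg [_ Lfg]] := Capprox f Df e e0.
have [_ Lf2 _] := DL Df; have [_ Lg2 _] := DL (CD g Cg).
have fg2 := L2B Lf2 Lg2.
rewrite -[X in `|X|]subr0 -(C0 g Cg) -RintegralB//; [|exact: L2_integrable..].
apply: (le_lt_trans (normr_Rintegral_le_norm2 fg2)).
by rewrite -lte_fin fineK// norm2_fin_num.
Qed.

Hypothesis L0 : forall f, D f -> \int[m]_z L f z = 0.

Let kact_D s f : 0 <= s -> D f -> D (kact P s f).
Proof.
move=> s0 Df; rewrite DE; exists (kact P s (L f)).
exact: (kact_generates Ptr PC0 s0 (DL Df)).
Qed.

Let law_L0 s f : 0 <= s -> D f -> \int[law s]_z L f z = 0.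
Proof.
move=> s0 Df; have [_ Lf2 _] := DL Df.
rewrite -(Rintegral_kact PC0)// -(L0 (kact_D s0 Df)).
apply: (generates_unique_Rintegral PC0).
  exact: (kact_generates Ptr PC0 s0 (DL Df)).
exact/DL/kact_D.
Qed.

(** As [L f] has zero integral under [law s], it can be subtracted from the difference quotient at
    no cost; what remains is small in L^2(m), hence under [law s]. *)
Let law_step K s t f e : 0 <= s -> 0 < t -> 0 <= K -> D f ->
  (forall g, g \in L2 m -> (\int[law s]_z `|g z|%:E <= K%:E * norm2 m g)%E) ->
  fine (norm2 m (fun z => t^-1 * (kact P t f z - f z) - L f z)) <= e ->
  `|\int[law (s + t)]_z f z - \int[law s]_z f z| <= t * (K * e).
Proof.
move=> s0 t0 K0 Df HK He; have [f2 Lf2 _] := DL Df.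
have Pf2 := kact_L2 PC0 (ltW t0) f2.
have d2 := L2B Pf2 f2; have w2 := L2B (L2Z t^-1 d2) Lf2.
have -> : \int[law (s + t)]_z f z - \int[law s]_z f z =
    t * \int[law s]_z (t^-1 * (kact P t f z - f z) - L f z).
  rewrite RintegralB//; last 2 first.
  - exact: (L2_integrable_law PC0 s0 (L2Z t^-1 d2)).
  - exact: (L2_integrable_law PC0).
  rewrite law_L0// subr0 RintegralZl//; last exact: (L2_integrable_law PC0 s0 d2).
  rewrite mulVKf ?gt_eqF// RintegralB//; [|exact: (L2_integrable_law PC0)..].
  by rewrite (Rintegral_law_kact Ptr PC0)// ltW.
rewrite normrM gtr0_norm// ler_pM2l//.
apply: (le_trans (normr_Rintegral_law_le PC0 s0 w2 (HK _ w2))).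
exact: ler_wpM2l.
Qed.

(** All grid times [k * dt] stay in [[0, h]], where [K] is common to the laws. The [n] errors
    [dt * K * e'] add up to [t * K * e'], whatever the number of steps. *)
Let law_short K h t f : 0 <= K ->
  (forall s, 0 <= s -> s <= h -> forall g, g \in L2 m ->
    (\int[law s]_z `|g z|%:E <= K%:E * norm2 m g)%E) ->
  0 <= t -> t <= h -> D f -> \int[law t]_z f z = \int[m]_z f z.
Proof.
move=> K0 HK; rewrite le_eqVlt => /predU1P[<- _ _|t0 th Df].
  exact: (Rintegral_law0 m Ptr).
apply/eqP; rewrite -subr_eq0 -normr_le0; apply/ler_addgt0Pl => e e0.
rewrite addr0.
(* Chosen so that the total error [t * K * e'] is [e * K / (K + 1)], at most [e]; the added 1 covers
   [K = 0]. *)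
pose e' := e / (t * (K + 1)).
have K1 : 0 < K + 1 by rewrite ltr_wpDl.
have e'0 : 0 < e' by rewrite divr_gt0// mulr_gt0.
have [r r0 Hr] := generatesP PC0 (DL Df) e'0.
(* More than [t / r] steps make [dt] smaller than [r], and the successor makes [n] nonzero. *)
pose n := (Num.bound (t / r)).+1.
pose dt := t / n%:R.
have n0 : 0 < n%:R :> R by rewrite ltr0n.
have dt0 : 0 < dt by rewrite divr_gt0.
have dtr : dt < r.
  rewrite ltr_pdivrMr// mulrC -ltr_pdivrMr//.
  have tr0 : 0 <= t / r by rewrite divr_ge0// ltW.
  by apply: (lt_trans (archi_boundP tr0)); rewrite ltr_nat.
have step k : (k < n)%N ->
    `|\int[law (k.+1%:R * dt)]_z f z - \int[law (k%:R * dt)]_z f z| <=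
    dt * (K * e').
  move=> kn; rewrite -natr1 mulrDl mul1r.
  apply: law_step => //; first by rewrite mulr_ge0// ltW.
  - apply: HK; first by rewrite mulr_ge0// ltW.
    apply: le_trans th; rewrite /dt mulrCA -[leRHS]mulr1 ler_pM2l//.
    by rewrite ler_pdivrMr// mul1r ler_nat ltnW.
  - exact/ltW/Hr.
have -> : \int[law t]_z f z - \int[m]_z f z =
    \sum_(0 <= k < n)
      (\int[law (k.+1%:R * dt)]_z f z - \int[law (k%:R * dt)]_z f z).
  rewrite telescope_sumr// mul0r (Rintegral_law0 m Ptr).
  by rewrite /dt mulrCA divff ?mulr1// gt_eqF.
apply: (le_trans (ler_norm_sum _ _ _)).
apply: (@le_trans _ _ (\sum_(0 <= k < n) (dt * (K * e')))).
  rewrite big_nat_cond [leRHS]big_nat_cond.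
  by apply: ler_sum => k /andP[/andP[_ kn] _]; exact: step.
rewrite big_const_nat subn0 iter_addr_0 -mulr_natl mulrA.
have -> : n%:R * dt = t by rewrite /dt mulrCA divff ?mulr1// gt_eqF.
have tn0 : t != 0 by rewrite gt_eqF.
have K1n0 : K + 1 != 0 by rewrite gt_eqF.
have -> : t * (K * e') = e * (K / (K + 1)).
  by rewrite /e'; field; rewrite tn0 K1n0.
by rewrite ler_piMr ?(ltW e0)// ler_pdivrMr// mul1r lerDl.
Qed.

(** Beyond [h] the uniform bound is lost, but the law at time [s] applied to [f] is the law at time
    [s - h] applied to [P_h f], again in the domain. The induction on the number of blocks thus
    quantifies over all functions of [D]. *)
Lemma generator_invariant_Rintegral t f : 0 <= t -> D f ->
  \int[law t]_z f z = \int[m]_z f z.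
Proof.
have [h h0 [K K0 HK]] := law_L2_locally_bounded.
have H n s g : 0 <= s -> s <= n%:R * h -> D g ->
    \int[law s]_z g z = \int[m]_z g z.
  elim: n s g => [|n IH] s g s0.
    rewrite mul0r => sle0 Dg.
    have -> : s = 0 by apply/eqP; rewrite eq_le sle0.
    exact: (Rintegral_law0 m Ptr).
  have [sh _|hs] := leP s h; first exact: law_short K0 HK s0 sh.
  rewrite -natr1 mulrDl mul1r => sn Dg; have [g2 _ _] := DL Dg.
  rewrite -[in LHS](subrK h s).
  rewrite -(Rintegral_law_kact Ptr PC0) ?subr_ge0//; [|exact: ltW..].
  rewrite IH ?subr_ge0 ?lerBlDr//; [|exact: ltW|apply: kact_D => //; exact: ltW].
  rewrite (Rintegral_kact PC0)//; last exact: ltW.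
  by apply: law_short K0 HK _ _ Dg => //; exact: ltW.
move=> t0; apply: (H (Num.bound (t / h))) => //.
rewrite -ler_pdivrMr//; apply/ltW/archi_boundP.
by rewrite divr_ge0// ltW.
Qed.

End invariance.

(** * Smooth compactly supported functions *)

Section flat_function.
Context {R : realType}.
Implicit Types x y : R.

(* The derivative of [flat n] is [flat n.+2 - n * flat n.+1], so that the whole
   family is differentiated at once. *)
Definition flat (n : nat) x : R :=
  if 0 < x then x^-1 ^+ n * expR (- x^-1) else 0.

Lemma flat_ge0 n x : 0 <= flat n x.
Proof.
rewrite /flat; case: ifPn => // x0.
by rewrite mulr_ge0 ?expR_ge0// exprn_ge0// invr_ge0 ltW.
Qed.

Lemma flat0_le1 x : flat 0 x <= 1.
Proof.
rewrite /flat; case: ifPn => // x0; rewrite expr0 mul1r.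
by rewrite -[leRHS]expR0 ler_expR oppr_le0 invr_ge0 ltW.
Qed.

Lemma flat0_eq0 x : (flat 0 x == 0) = (x <= 0).
Proof.
rewrite /flat leNgt; case: ifPn => [x0|]; last by rewrite eqxx.
by rewrite expr0 mul1r gt_eqF ?expR_gt0.
Qed.

(** One term of the exponential series: [e^y] dominates [y^(n+1) / (n+1)!], taken at [y = 1/x]. *)
Lemma flat_le_fact n x : flat n.+1 x <= n.+1`!%:R.
Proof.
rewrite /flat; case: ifPn => [x0|_]; last exact: ler0n.
rewrite expRN ler_pdivrMr ?expR_gt0// -ler_pdivrMl ?ltr0n ?fact_gt0//.
rewrite mulrC; have := @expR_ge1Dxn R x^-1 n.
rewrite invr_ge0 (ltW x0) => /(_ isT); apply: le_trans.
by rewrite lerDr.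
Qed.

Lemma flatS n x : flat n x = x * flat n.+1 x.
Proof.
rewrite /flat; case: ifPn => [x0|_]; last by rewrite mulr0.
by rewrite exprS -mulrA mulVKf// gt_eqF.
Qed.

Lemma is_derive_flat n x :
  is_derive x 1 (flat n) (flat n.+2 x - n%:R * flat n.+1 x).
Proof.
have [x0|x0|->] := ltgtP x 0.
- have -> : flat n.+2 x - n%:R * flat n.+1 x = 0.
    by rewrite /flat !ltNge !ltW//= mulr0 subr0.
  apply: (near_eq_is_derive (f := cst 0)).
  near=> y; rewrite /flat ltNge ltW//.
  by near: y; exact: lt_nbhsl.
- apply: (near_eq_is_derive (f := fun y => y^-1 ^+ n * expR (- y^-1))).
    near=> y; rewrite /flat ifT//.
    by near: y; exact: lt_nbhsr.
  have xN0 : x != 0 by rewrite gt_eqF.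
  have dV : is_derive x 1 (fun y : R => y^-1) (- x ^- 2 *: 1).
    exact: (is_deriveV xN0 (is_derive_id x 1)).
  have dE : is_derive x 1 (expR \o (fun y : R => - y^-1))
      (expR (- x^-1) * - (- x ^- 2 *: 1)).
    exact: (@is_derive1_comp R expR (fun y : R => - y^-1) x _ _
      (is_derive_expR (- x^-1)) (is_deriveN dV)).
  have dX : is_derive x 1 (fun y : R => y^-1 ^+ n) (- n%:R * x^-1 ^+ n.+1).
    have := is_deriveX n dV; rewrite exprfctE => /is_derive_eq; apply.
    rewrite /GRing.scale /= mulr1 -exprVn mulrN mulNr -mulrA -exprD addn2.
    by case: n => [|n]//; rewrite !mul0r.
  have := is_deriveM dX dE => /is_derive_eq; apply.
  rewrite /flat x0 /GRing.scale /= -exprVn.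
  by rewrite !exprS; ring.
- have -> : flat n.+2 0 - n%:R * flat n.+1 0 = 0 :> R.
    by rewrite /flat ltxx mulr0 subr0.
  (* At 0 the quotient is [flat n h / h = flat n.+1 h = h * flat n.+2 h], and the factorial bound on
     the last factor sends it to 0. *)
  have cv : h^-1 *: ((flat n \o shift 0) (h *: 1) - flat n 0)
      @[h --> 0^'] --> (0 : R).
    apply/cvgrPdist_lt => e e0.
    near=> h.
    have hN0 : h != 0 by near: h; exact: nbhs_dnbhs_neq.
    rewrite sub0r normrN /= addr0 [h *: 1]mulr1 [flat n 0]/flat ltxx subr0.
    rewrite -[X in `|X|]/(h^-1 * flat n h) flatS mulKf// flatS normrM.
    rewrite (ger0_norm (flat_ge0 _ _)).
    apply: (@le_lt_trans _ _ (`|h| * n.+2`!%:R)).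
      by rewrite ler_wpM2l// flat_le_fact.
    rewrite -ltr_pdivlMr ?ltr0n ?fact_gt0//.
    near: h; apply: dnbhs0_lt; rewrite divr_gt0// ltr0n fact_gt0//.
  apply: DeriveDef; first by apply/cvg_ex; exists 0.
  exact/cvg_lim.
Unshelve. all: by end_near. Qed.

End flat_function.

Section test_algebra.
Context {R : realType} {d : nat}.
Implicit Types (f g : 'rV[R]_d -> R) (p : 'rV[R]_d).

Lemma class_CW k f : class_C k.+1 f -> class_C k f.
Proof.
elim: k f => [|k IH] f; first by case.
move=> [cf df]; split => // i; have [dfi Cfi] := df i; split => //.
exact: IH.
Qed.

Lemma class_C_cst k (c : R) : class_C k (fun _ : 'rV[R]_d => c).
Proof.
elim: k c => [|k IH] c; first exact: cst_continuous.
split => [|i]; first exact: cst_continuous.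
have D p := is_derive_cst c p (delta_mx 0 i : 'rV[R]_d).
split=> [p|]; first by have [? _] := D p.
rewrite (_ : pderiv _ _ = fun=> 0); first exact: IH.
by apply/funext => p; have [] := D p.
Qed.

Lemma class_C_D k f g : class_C k f -> class_C k g ->
  class_C k (fun p => f p + g p).
Proof.
elim: k f g => [|k IH] f g.
  by move=> cf cg p; exact: (continuousD (cf p) (cg p)).
move=> [cf df] [cg dg]; split => [p|i]; first exact: (continuousD (cf p) (cg p)).
have [dfi Cfi] := df i; have [dgi Cgi] := dg i.
split=> [p|]; first exact: derivableD.
rewrite (_ : pderiv _ _ = fun p => pderiv i f p + pderiv i g p); first exact: IH.
by apply/funext => p; exact: deriveD.
Qed.

Lemma class_C_M k f g : class_C k f -> class_C k g ->
  class_C k (fun p => f p * g p).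
Proof.
elim: k f g => [|k IH] f g.
  by move=> cf cg p; exact: (continuousM (cf p) (cg p)).
move=> /[dup] /class_CW Cf [cf df] /[dup] /class_CW Cg [cg dg].
split => [p|i]; first exact: (continuousM (cf p) (cg p)).
have [dfi Cfi] := df i; have [dgi Cgi] := dg i.
split=> [p|]; first exact: derivableM.
rewrite (_ : pderiv _ _ = fun p => f p * pderiv i g p + g p * pderiv i f p).
  by apply: class_C_D; exact: IH.
by apply/funext => p; exact: deriveM.
Qed.

Lemma smooth_prod (I : Type) (s : seq I) (F : I -> 'rV[R]_d -> R) :
  (forall i, smooth (F i)) -> smooth (fun p => \prod_(i <- s) F i p).
Proof.
move=> sF k; elim: s => [|i s IH].
  by under [fun p => _]eq_fun do rewrite big_nil; exact: class_C_cst.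
under [fun p => _]eq_fun do rewrite big_cons.
by apply: class_C_M => //; exact: sF.
Qed.

(** Along [delta_mx 0 j] the difference quotient is exactly that of [G] at [p 0 i] when [i = j], and
    is identically 0 otherwise. *)
Lemma is_derive_coord (G : R -> R) (i j : 'I_d) p (dG : R) :
  is_derive (p 0 i) 1 G dG ->
  is_derive p (delta_mx 0 j) (fun q => G (q 0 i)) ((i == j)%:R * dG).
Proof.
have [-> [dGi GE]|ij _] := eqVneq i j.
  have E : (fun h : R => h^-1 *: (((fun q => G (q 0 j)) \o shift p)
      (h *: delta_mx 0 j) - G (p 0 j))) =
      (fun h : R => h^-1 *: ((G \o shift (p 0 j)) (h *: 1) - G (p 0 j))).
    apply/funext => h; congr (_ *: (_ - _)) => /=; congr G.
    by rewrite !mxE !eqxx.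
  split; first by rewrite /derivable E.
  by rewrite mul1r -GE /derive E.
rewrite mul0r.
have E : (fun h : R => h^-1 *: (((fun q => G (q 0 i)) \o shift p)
    (h *: delta_mx 0 j) - G (p 0 i))) = cst 0.
  apply/funext => h /=; rewrite !mxE (negbTE ij) eqxx/= mulr0 add0r subrr.
  by rewrite scaler0.
split; first by rewrite /derivable E; exact: is_cvg_cst.
by rewrite /derive E; exact: lim_cst.
Qed.

Lemma smooth_flat_affine n (c b : R) (i : 'I_d) :
  smooth (fun p => flat n (c * p 0 i + b)).
Proof.
move=> k.
have D m (x : R) : is_derive x 1 (fun y => flat m (c * y + b))
    (c * (flat m.+2 (c * x + b) - m%:R * flat m.+1 (c * x + b))).
  have dl : is_derive x 1 (fun y : R => c * y + b) c.
    have := is_deriveD (is_deriveM (is_derive_cst c x 1) (is_derive_id x 1))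
      (is_derive_cst b x 1).
    move=> /is_derive_eq; apply.
    by rewrite /GRing.scale /= mulr1 mulr0 !addr0.
  have := @is_derive1_comp R (flat m) (fun y : R => c * y + b) x _ _
    (is_derive_flat m (c * x + b)) dl.
  by move=> /is_derive_eq; apply; rewrite mulrC.
have cont m : continuous (fun p : 'rV[R]_d => flat m (c * p 0 i + b)).
  move=> p; apply: (@continuous_comp _ _ _ (fun q : 'rV[R]_d => q 0 i)
    (fun y => flat m (c * y + b))); first exact: coord_continuous.
  apply: differentiable_continuous; apply/derivable1_diffP.
  by have [? _] := D m (p 0 i).
elim: k n => [|k IH] n; first exact: cont.
split => [|j]; first exact: cont.
have Dn p := @is_derive_coord (fun y => flat n (c * y + b)) i j p _ (D n (p 0 i)).
split => [p|]; first by have [? _] := Dn p.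
rewrite (_ : pderiv _ _ = fun p => (i == j)%:R *
   (c * (flat n.+2 (c * p 0 i + b) + - n%:R * flat n.+1 (c * p 0 i + b)))).
  do 2 (apply: class_C_M; first exact: class_C_cst).
  apply: class_C_D => //.
  by apply: class_C_M => //; exact: class_C_cst.
by apply/funext => p; rewrite mulNr; have [] := Dn p.
Qed.

Lemma test_rV_support f (K : set 'rV[R]_d) : smooth f -> compact K -> closed K ->
  (forall p, f p != 0 -> K p) -> test_rV f.
Proof.
move=> sf cK clK fK; split => //.
apply: (subclosed_compact _ cK); first exact: closed_closure.
by rewrite ((closure_id K).1 clK); exact: closureS.
Qed.

Lemma test_rVM f g : test_rV f -> smooth g -> test_rV (fun p => f p * g p).
Proof.
move=> [sf cf] sg; apply: (test_rV_support _ cf); last 2 first.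
- exact: closed_closure.
- by move=> p; rewrite mulf_eq0 negb_or => /andP[fp _]; exact: subset_closure.
by move=> k; exact: class_C_M.
Qed.

Lemma test_rVD f g : test_rV f -> test_rV g -> test_rV (fun p => f p + g p).
Proof.
move=> [sf cf] [sg cg]; apply: (test_rV_support _ (compactU cf cg)).
- by move=> k; exact: class_C_D.
- by apply: closedU; exact: closed_closure.
- move=> p; have [fp|fp _] := eqVneq (f p) 0; last first.
    by left; exact: subset_closure.
  by rewrite fp add0r => gp; right; exact: subset_closure.
Qed.

Lemma test_rV0 : test_rV (fun _ : 'rV[R]_d => 0).
Proof.
apply: (test_rV_support _ compact0); last 2 first.
- exact: closed0.
- by move=> p /eqP.
by move=> k; exact: class_C_cst.
Qed.

(** The two factors in coordinate [i] are positive for [p 0 i > a 0 i - r] and [p 0 i < a 0 i + r]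
    respectively. The coefficients [1] and [- 1] are kept explicit to match the affine form of
    [smooth_flat_affine]. *)
Definition box_bump (a : 'rV[R]_d) (r : R) p : R :=
  \prod_(i < d) (flat 0 (1 * p 0 i + (r - a 0 i)) *
                 flat 0 (- 1 * p 0 i + (r + a 0 i))).

Lemma box_bump_ge0 a r p : 0 <= box_bump a r p.
Proof. by apply: prodr_ge0 => i _; rewrite mulr_ge0// flat_ge0. Qed.

Lemma box_bump_le1 a r p : box_bump a r p <= 1.
Proof.
apply: prodr_ile1 => i; rewrite mulr_ge0 ?flat_ge0//=.
by rewrite mulr_ile1 ?flat_ge0// flat0_le1.
Qed.

Lemma box_bump_neq0 a r p :
  (box_bump a r p != 0) <-> (forall i, `|a 0 i - p 0 i| < r).
Proof.
have E i : (flat 0 (1 * p 0 i + (r - a 0 i)) *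
    flat 0 (- 1 * p 0 i + (r + a 0 i)) != 0) = (`|a 0 i - p 0 i| < r).
  rewrite mulf_eq0 negb_or !flat0_eq0 -!ltNge mul1r mulN1r ltr_norml andbC.
  by congr (_ && _); apply/idP/idP => ?; lra.
split=> [/prodf_neq0 H i|H]; first by rewrite -E H.
by apply/prodf_neq0 => i _; rewrite E.
Qed.

Lemma test_box_bump a r : test_rV (box_bump a r).
Proof.
pose K := [set p : 'rV[R]_d | forall i, `[a 0 i - r, a 0 i + r]%classic (p 0 i)].
have cK : compact K.
  have := @rV_compact R d (fun i => `[a 0 i - r, a 0 i + r]%classic).
  by apply => i; exact: segment_compact.
apply: (test_rV_support _ cK).
- by apply: smooth_prod => i k; apply: class_C_M; exact: smooth_flat_affine.
- apply: compact_closed => //; exact: norm_hausdorff.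
- move=> p /box_bump_neq0 H i /=; have := H i.
  rewrite in_itv /= ltr_norml => /andP[? ?]; apply/andP; split; lra.
Qed.

End test_algebra.

Section test_bounded.
Context {R : realType} {d : nat}.
Implicit Types f : 'rV[R]_d -> R.

Lemma continuous_borel_measurable f : continuous f ->
  measurable_fun [set: borel_rV R d] (f : borel_rV R d -> R).
Proof.
move=> /continuousP cf; apply: (measurability _ (RGenOpens.measurableE R)).
move=> _ [_ [a [b ->] <-]]; rewrite setTI; apply: sub_sigma_algebra.
exact/cf/interval_open.
Qed.

Lemma compact_support_bounded f (K : set 'rV[R]_d) : continuous f -> compact K ->
  (forall p, ~ K p -> f p = 0) -> exists M, forall p, `|f p| <= M.
Proof.
move=> cf cK fK.
have : compact (f @` K).
  by apply: continuous_compact => //; exact: continuous_subspaceT.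
move=> /compact_bounded[M [_ HM]]; exists (Num.max (M + 1) 0) => p.
have [Kp|/fK ->] := pselect (K p); last by rewrite normr0 le_max lexx orbT.
by rewrite le_max; apply/orP; left; apply: (HM (M + 1)); [rewrite ltrDl|exists p].
Qed.

Lemma test_measurable f : test_rV f ->
  measurable_fun [set: borel_rV R d] (f : borel_rV R d -> R).
Proof. by move=> [sf _]; apply: continuous_borel_measurable; exact: (sf 0%N). Qed.

Lemma test_bounded f : test_rV f -> exists M, forall p, `|f p| <= M.
Proof.
move=> [sf cf]; apply: (compact_support_bounded (sf 0%N) cf) => p Kp.
have [//|fp] := eqVneq (f p) 0; exfalso; apply: Kp; exact: subset_closure.
Qed.

Lemma test_pderiv_measurable f i : test_rV f ->
  measurable_fun [set: borel_rV R d] (pderiv i f : borel_rV R d -> R).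
Proof.
by move=> [sf _]; apply: continuous_borel_measurable; have [_ /(_ i)[_]] := sf 1%N.
Qed.

Lemma test_pderiv_bounded f i : test_rV f ->
  exists M, forall p, `|pderiv i f p| <= M.
Proof.
move=> [sf cf]; have cpf : continuous (pderiv i f).
  by have [_ /(_ i)[_]] := sf 1%N.
apply: (compact_support_bounded cpf cf) => p Kp.
rewrite /pderiv (near_eq_derive (g := cst 0)).
  by have [_ ->] := is_derive_cst (0 : R) p (delta_mx 0 i : 'rV[R]_d).
have oK : open (~` closure [set p | f p != 0]).
  by apply: closed_openC; exact: closed_closure.
have := open_nbhs_nbhs (conj oK Kp); apply: filterS => q Kq.
have [//|fq] := eqVneq (f q) 0; exfalso; apply: Kq; exact: subset_closure.
Qed.

End test_bounded.

(** * Test functions on the phase space determine measures *)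

Lemma countType_bigcup_measurable (disp : measure_display)
    (T : measurableType disp) (I : countType) (Q : set I) (F : I -> set T) :
  (forall i, Q i -> measurable (F i)) -> measurable (\bigcup_(i in Q) F i).
Proof.
move=> mF; rewrite (_ : \bigcup_(i in Q) F i =
  \bigcup_n \bigcup_(i in [set i | Q i /\ unpickle n = Some i]) F i).
  apply: bigcupT_measurable => n; case E : (unpickle n : option I) => [i|].
    have [Qi|nQi] := pselect (Q i).
      rewrite (_ : [set _ | _] = [set i]) ?bigcup_set1; first exact: mF.
      by apply/seteqP; split => [j [_ [->]]|j ->].
    rewrite (_ : [set _ | _] = set0) ?bigcup_set0//.
    by apply/seteqP; split => // j [Qj [ij]]; apply: nQi; rewrite ij.
  rewrite (_ : [set _ | _] = set0) ?bigcup_set0//.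
  by apply/seteqP; split => // j [].
apply/seteqP; split=> [x [i Qi Fi]|x [n _ [i [Qi _] Fi]]]; last by exists i.
by exists (pickle i) => //; exists i => //; split => //; rewrite pickleK.
Qed.

Section test_phase_theory.
Context {X : pfinType} {R : realType} {d : nat}.
Implicit Types (F : phase X R d -> R) (m : {measure set (phase X R d) -> \bar R}).

Lemma measurable_phase (disp' : measure_display) (U : measurableType disp')
    (F : phase X R d -> U) :
  (forall x, measurable_fun [set: borel_rV R d] (fun p => F (x, p))) ->
  measurable_fun setT F.
Proof.
move=> mF _ B mB; rewrite setTI.
rewrite (_ : F @^-1` B = \bigcup_(x in [set: X])
  ([set x] `*` ((fun p => F (x, p)) @^-1` B))).
  apply: countType_bigcup_measurable => x _; apply: measurableX => //.
  by rewrite -[X in measurable X]setTI; exact: mF.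
apply/seteqP; split=> [[x p] /= Bp|[x p] /= [y _ [/= -> //]]].
by exists x.
Qed.

Lemma test_phase_measurable F : test_phase F -> measurable_fun setT F.
Proof. by move=> tF; apply: measurable_phase => x; exact: test_measurable. Qed.

Lemma test_phase_integrable m F : (m setT < +oo)%E -> test_phase F ->
  m.-integrable setT (EFin \o F).
Proof.
move=> mT tF; apply: measurable_bounded_integrable => //.
  exact: test_phase_measurable.
have [M HM] := choice (fun x => test_bounded (tF x)).
exists (\sum_x `|M x|); split; first exact: num_real.
move=> y My [x p] _ /=; apply: (le_trans (HM x p)).
apply/ltW; apply: le_lt_trans My.
by rewrite (bigD1 x)//= (le_trans (ler_norm _))// lerDl sumr_ge0.
Qed.

Lemma test_phaseM F G : test_phase F -> test_phase G ->
  test_phase (fun z => F z * G z).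
Proof. by move=> tF tG x; apply: test_rVM => //; case: (tG x). Qed.

Lemma test_phaseD F G : test_phase F -> test_phase G ->
  test_phase (fun z => F z + G z).
Proof. by move=> tF tG x; exact: test_rVD. Qed.

Lemma test_phaseZ c F : test_phase F -> test_phase (fun z => F z * c).
Proof. by move=> tF x; apply: test_rVM => // k; exact: class_C_cst. Qed.

Lemma test_phase_indicator (x : X) (f : 'rV[R]_d -> R) : test_rV f ->
  test_phase (fun z : phase X R d => if (z.1 : X) == x then f z.2 else 0).
Proof.
by move=> tf y /=; case: (y == x) => //; exact: test_rV0.
Qed.

(* Increases to the indicator of [F != 0] when [0 <= F <= 1]. *)
Let saturate F (n : nat) (z : phase X R d) : R := 1 - (1 - F z) ^+ n.

(** Constants need not have compact support, so the formula is not read as a difference of test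
    functions; the recursion [s_(n+1) = s_n + F - F * s_n] stays among sums and products of test
    functions. *)
Lemma test_saturate F n : test_phase F ->
  test_phase (fun z => 1 - (1 - F z) ^+ n).
Proof.
rewrite -/(saturate F n).
move=> tF; elim: n => [|n IH].
  rewrite (_ : saturate F 0 = fun=> 0); first by move=> x; exact: test_rV0.
  by apply/funext => z; rewrite /saturate expr0 subrr.
rewrite (_ : saturate F n.+1 =
  fun z => saturate F n z + (F z + (F z * saturate F n z) * -1)).
  apply: test_phaseD => //; apply: test_phaseD => //.
  by apply: test_phaseZ; exact: test_phaseM.
by apply/funext => z; rewrite /saturate exprS; ring.
Qed.

Lemma test_support_measure m F : (m setT < +oo)%E -> test_phase F ->
  (forall z, 0 <= F z <= 1) ->
  (\int[m]_z (1 - (1 - F z) ^+ n)%:E)%E @[n --> \oo] --> m [set z | F z != 0].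
Proof.
move=> mT tF F01.
have F01' z : 0 <= 1 - F z <= 1.
  by have /andP[? ?] := F01 z; apply/andP; split; lra.
have mU : measurable [set z | F z != 0].
  rewrite (_ : [set _ | _] = F @^-1` (~` [set 0])); last first.
    by apply/seteqP; split => z /= /eqP.
  rewrite -[X in measurable X]setTI; apply: test_phase_measurable => //.
  by apply: measurableC; exact: measurable_set1.
have -> : m [set z | F z != 0] =
    (\int[m]_z limn (fun n => (saturate F n z)%:E))%E.
  transitivity (\int[m]_z (\1_[set z | F z != 0] z)%:E)%E.
    by rewrite integral_indic// setIT.
  apply: eq_integral => z _; apply/esym/cvg_lim => //.
  have [Fz|Fz] := eqVneq (F z) 0.
    rewrite indicE memNset; last by rewrite /= Fz eqxx.
    rewrite (_ : (fun n => _) = cst 0%:E); first exact: cvg_cst.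
    by apply/funext => n; rewrite /saturate Fz subr0 expr1n subrr.
  rewrite indicE mem_set//=.
  apply: cvg_EFin; first by near=> n.
  rewrite -[X in _ --> X]subr0; apply: cvgB; first exact: cvg_cst.
  apply: cvg_expr; have /andP[F0 F1] := F01' z.
  rewrite ger0_norm// ltrBlDr ltrDl.
  by have /andP[Fge0 _] := F01 z; rewrite lt_neqAle eq_sym Fz.
apply: cvg_monotone_convergence => //.
- move=> n; apply/measurable_EFinP.
  exact: (test_phase_measurable (@test_saturate F n tF)).
- move=> n z _; rewrite lee_fin subr_ge0.
  by have /andP[? ?] := F01' z; exact: exprn_ile1.
- move=> z _ a b ab; rewrite lee_fin lerD2l lerN2.
  by have /andP[? ?] := F01' z; exact: ler_wiXn2l.
Unshelve. all: by end_near. Qed.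

End test_phase_theory.

Section test_measure_unique.
Context {X : pfinType} {R : realType} {d : nat}.
Implicit Types (F : phase X R d -> R) (m : {measure set (phase X R d) -> \bar R}).

(** A pi-system: products of test functions yield intersections. The mass of each of its sets is a
    limit of integrals of test functions, by [test_support_measure]. *)
Let supports : set (set (phase X R d)) := [set U | exists F,
  [/\ test_phase F, (forall z, 0 <= F z <= 1) & U = [set z | F z != 0]]].

Let test_box_bump_at (x : X) a r : test_phase (fun z : phase X R d =>
  if (z.1 : X) == x then box_bump a r z.2 else 0).
Proof. by apply: test_phase_indicator; exact: test_box_bump. Qed.

Let supports_box (x : X) a r :
  supports [set z | (z.1 : X) = x /\ box_bump a r z.2 != 0].
Proof.
exists (fun z : phase X R d => if (z.1 : X) == x then box_bump a r z.2 else 0).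
split; first exact: test_box_bump_at.
  by move=> z; case: ifPn => _; rewrite ?lexx ?ler01// box_bump_ge0 box_bump_le1.
apply/seteqP; split => [[y p] /= [-> pr]|[y p] /=]; first by rewrite eqxx.
by case: (eqVneq y x) => // _; rewrite eqxx.
Qed.

Let supports_ball n :
  supports [set z | box_bump (0 : 'rV[R]_d) n%:R z.2 != 0].
Proof.
exists (fun z : phase X R d => box_bump 0 n%:R z.2); split => //.
  by move=> x; exact: test_box_bump.
by move=> z; rewrite box_bump_ge0 box_bump_le1.
Qed.

Let cover_ball (p : 'rV[R]_d) : exists n : nat, box_bump 0 n%:R p != 0.
Proof.
exists (Num.bound (\sum_i `|p 0 i|)); apply/box_bump_neq0 => i.
apply: le_lt_trans (archi_boundP _); last exact: sumr_ge0.
by rewrite mxE sub0r normrN (bigD1 i)//= lerDl sumr_ge0.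
Qed.

Let supports_sub_measurable : supports `<=` measurable.
Proof.
move=> _ [F [tF _ ->]]; rewrite (_ : [set _ | _] = F @^-1` (~` [set 0])).
  rewrite -[X in measurable X]setTI; apply: test_phase_measurable => //.
  by apply: measurableC; exact: measurable_set1.
by apply/seteqP; split => z /= /eqP.
Qed.

Let supports_setI : setI_closed supports.
Proof.
move=> _ _ [F [tF F01 ->]] [G [tG G01 ->]].
exists (fun z => F z * G z); split; first exact: test_phaseM.
  move=> z; have /andP[? ?] := F01 z; have /andP[? ?] := G01 z.
  by rewrite mulr_ge0//= mulr_ile1.
apply/seteqP; split => z /=; rewrite mulf_eq0 negb_or; first by case => -> ->.
by case/andP.
Qed.

(** Rational centres and radii make the union countable, which brings open sets into the
    sigma-algebra generated by the boxes. *)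
Lemma open_rational_box (U : set 'rV[R]_d) : open U ->
  U = \bigcup_(cr in [set cr : 'rV[rat]_d * rat |
        forall q, box_bump (map_mx ratr cr.1) (ratr cr.2) q != 0 -> U q])
      [set q | box_bump (map_mx ratr cr.1) (ratr cr.2) q != 0].
Proof.
move=> oU; apply/seteqP; split=> [p Up|p [cr /= H /H //]].
have [e /= e0 He] : nbhs_ball p U by exact/nbhs_ballP/open_nbhs_nbhs.
(* Both [p] and any [q] of the box lie within [r < e / 2] of its centre in each coordinate, hence
   within [e] of each other. *)
have e20 : 0 < e / 2 by rewrite divr_gt0.
have [r] := rat_in_itvoo e20; rewrite in_itv /= => /andP[r0 re].
have Hc (i : 'I_d) : exists c : rat, `|ratr c - p 0 i| < ratr r.
  have : p 0 i - ratr r < p 0 i + ratr r by lra.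
  move=> /rat_in_itvoo[c]; rewrite in_itv /= => /andP[c1 c2].
  by exists c; rewrite ltr_norml; apply/andP; split; lra.
have {Hc} [c Hc] := choice Hc.
exists (\row_i c i, r) => /=; last first.
  by apply/box_bump_neq0 => i; rewrite !mxE.
move=> q /box_bump_neq0 Hq; apply: He; split => // i j.
rewrite ord1 /ball /=.
have := Hq j; have := Hc j; rewrite !mxE => A B.
rewrite (_ : p 0 j - q 0 j =
  (ratr (c j) - q 0 j) - (ratr (c j) - p 0 j)); last by ring.
apply: (le_lt_trans (ler_normB _ _)); lra.
Qed.

(** The identity map from the phase space with the sigma-algebra generated by [supports] to the
    product is measurable because both projections are. *)
Let sigma_supports : measurable `<=` <<s supports >>.
Proof.
pose Y := g_sigma_algebraType supports.
have mG (U : set (phase X R d)) : supports U -> measurable (U : set Y).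
  exact: sub_sigma_algebra.
have mfst : measurable_fun [set: Y] (fst : Y -> discrete_fin X).
  (* Test functions have compact support, so each slice [{x} x R^d] is exhausted by boxes of integer
     radius. *)
  move=> _ A _; rewrite setTI (_ : fst @^-1` A =
    \bigcup_(xn in [set xn : X * nat | A xn.1])
      [set z : phase X R d | (z.1 : X) = xn.1 /\ box_bump 0 xn.2%:R z.2 != 0]).
    by apply: (@countType_bigcup_measurable _ Y) => xn _; exact: mG.
  apply/seteqP; split => [[x p] /= Ax|[x p] /= [[y n] /= Ay [-> //]]].
  by have [n pn] := cover_ball p; exists (x, n).
have msnd : measurable_fun [set: Y] (snd : Y -> borel_rV R d).
  apply: (@measurability _ _ Y (borel_rV R d) setT snd (@open 'rV[R]_d)) => //.
  move=> _ [U oU <-].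
  rewrite setTI {1}(open_rational_box oU).
  set Q := (X in bigcup X).
  rewrite (_ : snd @^-1` _ =
     \bigcup_(xcr in [set xcr : X * ('rV[rat]_d * rat) | Q xcr.2])
     [set z : phase X R d | (z.1 : X) = xcr.1 /\
        box_bump (map_mx ratr xcr.2.1) (ratr xcr.2.2) z.2 != 0]).
    by apply: (@countType_bigcup_measurable _ Y) => xn _; exact: mG.
  apply/seteqP; split => [[x p] /= [cr Qcr pcr]|[x p] /= [[y cr] /= Qcr [_ pcr]]].
    by exists (x, cr).
  by exists cr.
move=> A mA.
have := measurable_fun_pair mfst msnd measurableT mA.
rewrite setTI (_ : _ @^-1` A = A)//.
by apply/seteqP; split => -[].
Qed.

Lemma test_measure_unique m1 m2 : m1 setT = 1%E -> m2 setT = 1%E ->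
  (forall F, test_phase F -> \int[m1]_z F z = \int[m2]_z F z) ->
  forall A, measurable A -> m1 A = m2 A.
Proof.
move=> m1T m2T m12 A mA.
have m1y : (m1 setT < +oo)%E by rewrite m1T ltry.
have m2y : (m2 setT < +oo)%E by rewrite m2T ltry.
apply: (@g_sigma_algebra_measure_unique _ R _ supports supports_sub_measurable
  (fun n => [set z | box_bump (0 : 'rV[R]_d) n%:R z.2 != 0])) => //.
- apply/seteqP; split => // -[x p] _ /=.
  by have [n pn] := cover_ball p; exists n.
- move=> _ [F [tF F01 ->]].
  have c1 := test_support_measure m1y tF F01.
  have c2 := test_support_measure m2y tF F01.
  apply: (cvg_unique _ c1) => //.
  rewrite (_ : (fun n => _) = (fun n => \int[m2]_z (1 - (1 - F z) ^+ n)%:E)%E)//.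
  apply/funext => n; have tS := test_saturate n tF.
  have i1 := test_phase_integrable m1y tS; have i2 := test_phase_integrable m2y tS.
  rewrite -[LHS](fineK (integrable_fin_num measurableT i1)).
  rewrite -[RHS](fineK (integrable_fin_num measurableT i2)).
  by congr EFin; exact: m12 tS.
- move=> n; apply: le_lt_trans m1y; apply: le_measure; rewrite ?inE//.
  exact: supports_sub_measurable.
- exact: sigma_supports.
Qed.

End test_measure_unique.

(** * Integrals over the phase space *)

Section phase_integral.
Context {X : pfinType} {R : realType} {d : nat}.
Variables (pi : probability (discrete_fin X) R)
  (rho : probability (borel_rV R d) R).

Lemma pmassE (x : X) : pi [set x] = (pmass pi x)%:E.
Proof. by rewrite fineK// fin_num_measure. Qed.

Lemma pmass_ge0 (x : X) : 0 <= pmass pi x.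
Proof. by rewrite fine_ge0. Qed.

Lemma integral_discrete_fin (G : X -> R) :
  (\int[pi]_x (G x)%:E)%E = (\sum_x pmass pi x * G x)%:E.
Proof.
transitivity (\int[pi]_y (\sum_x (G x)%:E * (\1_[set x] y)%:E))%E.
  apply: eq_integral => y _; rewrite (bigD1 (y : X))//= indicE mem_set//= mule1.
  rewrite big1 ?adde0// => x xy; rewrite indicE memNset ?mule0//=.
  by move=> /esym /eqP; exact/negP.
rewrite (@integral_sum _ _ _ pi setT measurableT X
  (fun x y => (G x)%:E * (\1_[set x] y)%:E)%E); last first.
  by move=> x; apply: integrableZl => //; exact: integrable_indic.
rewrite -sumEFin; apply: eq_bigr => x _.
rewrite integralZl//; last exact: integrable_indic.
by rewrite integral_indic// setIT mulrC EFinM; congr (_ * _)%E; exact: pmassE.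
Qed.

Lemma ae_discrete_finP (A : X -> Prop) :
  {ae pi, forall x : discrete_fin X, A x} <-> (forall x, 0 < pmass pi x -> A x).
Proof.
split=> [[B [_ piB AB]] x x0|H].
  apply: contrapT => nA; have Bx : B x by exact: AB.
  have : (pi [set x] <= pi B)%E.
    by apply: le_measure; rewrite ?inE// => y ->.
  by rewrite piB pmassE lee_fin leNgt x0.
exists [set x : discrete_fin X | pmass pi x = 0]; split => //.
- transitivity (\int[pi]_x (\1_[set x : discrete_fin X | pmass pi x = 0] x)%:E)%E.
    by rewrite integral_indic// setIT.
  rewrite (integral_discrete_fin
    (fun x => \1_[set x : discrete_fin X | pmass pi x = 0] x)).
  rewrite big1// => x _; rewrite indicE.
  have [x0|x0] := eqVneq (pmass pi x) 0; first by rewrite x0 mul0r.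
  by rewrite memNset ?mulr0//=; exact/eqP.
- move=> x /= nA; apply: contrapT => x0; apply: nA; apply: H.
  by rewrite lt_neqAle pmass_ge0 andbT eq_sym; exact/eqP.
Qed.

Variable F : phase X R d -> R.
Hypothesis iF : forall x, rho.-integrable setT (EFin \o (fun p => F (x, p))).

Lemma measurable_phase_sections : measurable_fun setT F.
Proof.
apply: measurable_phase => x; apply/measurable_EFinP.
exact: measurable_int (iF x).
Qed.

Lemma integrable_phase : (pi \x rho)%E.-integrable setT (EFin \o F).
Proof.
apply/integrable12ltyP.
  by apply/measurable_EFinP; exact: measurable_phase_sections.
rewrite (eq_integral (fun x : discrete_fin X => (\int[rho]_p `|F (x, p)|)%:E)).
  by rewrite (integral_discrete_fin (fun x => \int[rho]_p `|F (x, p)|)) ltry.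
move=> x _; rewrite /Rintegral fineK//.
exact: (integrable_fin_num measurableT (integrable_norm (iF x))).
Qed.

Lemma Rintegral_phase : \int[(pi \x rho)%E]_z F z =
  \sum_x pmass pi x * \int[rho]_p F (x, p).
Proof.
rewrite /Rintegral -(integral12_prod_meas1 integrable_phase).
rewrite (eq_integral (fun x : discrete_fin X => (\int[rho]_p F (x, p))%:E)).
  by rewrite (integral_discrete_fin (fun x => \int[rho]_p F (x, p))).
move=> x _; rewrite /fubini_F /Rintegral fineK//.
exact: (integrable_fin_num measurableT (iF x)).
Qed.

End phase_integral.

(** * The integral of the jump and drift part *)

Section jump_drift_integral.
Context {X : pfinType} {R : realType} {d : nat}.
Variables (pi : probability (discrete_fin X) R)
  (rho : probability (borel_rV R d) R).
Variables (Q : X -> X -> 'rV[R]_d -> R) (mu : X -> 'rV[R]_d -> 'rV[R]_d).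
Hypothesis hQ2 : forall x y : X, (Q x y : borel_rV R d -> R) \in L2 rho.
Hypothesis hmu2 : forall (x : X) (i : 'I_d),
  ((fun p => mu x p 0 i) : borel_rV R d -> R) \in L2 rho.
Hypothesis hQsupp : forall x y : X, ~ ([set x; y] `<=` psupp pi) ->
  forall p : 'rV[R]_d, Q x y p = 0.

Lemma L2_bounded_integrable (g h : borel_rV R d -> R) M : g \in L2 rho ->
  measurable_fun setT h -> (forall p, `|h p| <= M) ->
  rho.-integrable setT (EFin \o (fun p => g p * h p)).
Proof.
move=> g2 mh hM.
apply: (integrableMl measurableT (L2_integrable g2) mh).
exists M; split; first exact: num_real.
by move=> x Mx p _ /=; apply: (le_trans (hM p)); exact: ltW.
Qed.

Variable f : phase X R d -> R.
Hypothesis tf : test_phase f.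

Let iQ x y : rho.-integrable setT
  (EFin \o (fun p : borel_rV R d => Q x y p * f (y, p))).
Proof.
have [M HM] := test_bounded (tf y).
exact: (L2_bounded_integrable (hQ2 x y) (test_measurable (tf y)) HM).
Qed.

Let imu x : rho.-integrable setT (EFin \o (fun p : borel_rV R d =>
  dotp (mu x p) (grad (fun p => f (x, p)) p))).
Proof.
rewrite (_ : EFin \o _ = (fun p : borel_rV R d => \sum_(i < d)
    (EFin \o (fun p => mu x p 0 i * pderiv i (fun p => f (x, p)) p)%R) p)%E).
  apply: integrable_sum => // i _.
  have [M HM] := test_pderiv_bounded i (tf x).
  exact: (L2_bounded_integrable (hmu2 x i) (test_pderiv_measurable i (tf x)) HM).
apply/funext => p; rewrite /= sumEFin; congr EFin.
by apply: eq_bigr => i _; rewrite mxE.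
Qed.

Let iQs x : rho.-integrable setT
  (EFin \o (fun p : borel_rV R d => \sum_y Q x y p * f (y, p))).
Proof.
rewrite (_ : EFin \o _ = (fun p : borel_rV R d => \sum_y
    (EFin \o (fun p => Q x y p * f (y, p))%R) p)%E).
  by apply: integrable_sum => // y _; exact: iQ.
by apply/funext => p; rewrite /= sumEFin.
Qed.

Lemma integrable_LH_section x :
  rho.-integrable setT (EFin \o (fun p : borel_rV R d => LH Q mu f (x, p))).
Proof. by have := integrableD measurableT (iQs x) (imu x). Qed.

Let Rintegral_sum (I : finType) (c : I -> R) (g : I -> borel_rV R d -> R) :
  (forall i, rho.-integrable setT (EFin \o g i)) ->
  \int[rho]_p (\sum_i c i * g i p) = \sum_i c i * \int[rho]_p g i p.
Proof.
move=> ig.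
transitivity (fine (\sum_i (\int[rho]_p (c i * g i p))%:E)%E); last first.
  by rewrite sumEFin /=; apply: eq_bigr => i _; rewrite RintegralZl.
congr fine.
transitivity (\int[rho]_p (\sum_i (EFin \o (fun p => c i * g i p)%R) p))%E.
  by apply: eq_integral => p _ /=; rewrite sumEFin.
rewrite integral_sum//; last first.
  by move=> i; exact: (integrableZl measurableT (c i) (ig i)).
apply: eq_bigr => i _; rewrite /Rintegral fineK//.
exact: (integrable_fin_num measurableT (integrableZl measurableT (c i) (ig i))).
Qed.

(** The factor [pi_y] cancels the denominator in [q_]. If [pi_y = 0], the left side is 0 and the
    support hypothesis makes every [Q x y] vanish on the right. *)
Let Rintegral_q y : pmass pi y * \int[rho]_p (f (y, p) * q_ pi Q y p) =
  \sum_x pmass pi x * \int[rho]_p (Q x y p * f (y, p)).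
Proof.
rewrite -Rintegral_sum; last by move=> x; exact: iQ.
have [y0|y0] := eqVneq (pmass pi y) 0.
  rewrite y0 mul0r; apply/esym; transitivity (\int[rho]__ (0 : R)); last first.
    by rewrite Rintegral_cst// mul0r.
  apply: eq_Rintegral => p _; apply: big1 => x _.
  rewrite (@hQsupp x y) ?mul0r ?mulr0//.
  by move=> /(_ y (or_intror erefl)); rewrite /psupp /= y0 ltxx.
have sy : y \in psupp pi.
  by rewrite mem_set// /psupp /= lt_neqAle eq_sym y0 pmass_ge0.
have E p : f (y, p) * q_ pi Q y p =
    \sum_x (pmass pi x / pmass pi y) * (Q x y p * f (y, p)).
  rewrite /q_ sy mulr_sumr; apply: eq_bigr => x _; ring.
under eq_Rintegral do rewrite E.
rewrite !Rintegral_sum; [|by move=> x; exact: iQ..].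
rewrite mulr_sumr; apply: eq_bigr => x _.
by field.
Qed.

Lemma Rintegral_LH : \int[(pi \x rho)%E]_z LH Q mu f z =
  \sum_x pmass pi x * (\int[rho]_p dotp (grad (fun p => f (x, p)) p) (mu x p) +
                       \int[rho]_p (f (x, p) * q_ pi Q x p)).
Proof.
rewrite (Rintegral_phase pi integrable_LH_section).
under [RHS]eq_bigr do rewrite mulrDr Rintegral_q.
(* [q_] groups the jumps by arrival point; the exchange of sums regroups them by departure point, as
   in [LH]. *)
rewrite [RHS]big_split /= [X in _ = _ + X]exchange_big /= addrC -big_split /=.
apply: eq_bigr => x _.
rewrite -mulr_sumr -mulrDr; congr (_ * _).
transitivity (\int[rho]_p (\sum_y Q x y p * f (y, p)) +
  \int[rho]_p dotp (mu x p) (grad (fun p => f (x, p)) p)).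
  by rewrite -RintegralD//; exact: iQs.
congr (_ + _).
  have := @Rintegral_sum X (fun=> 1) (fun y p => Q x y p * f (y, p)) (iQ x).
  under [X in _ = X -> _]eq_bigr do rewrite mul1r.
  by move=> <-; apply: eq_Rintegral => p _; apply: eq_bigr => y _; rewrite mul1r.
by apply: eq_Rintegral => p _; apply: eq_bigr => i _; rewrite mulrC.
Qed.

End jump_drift_integral.

Lemma grad0 (R : realType) (d : nat) (p : 'rV[R]_d) :
  grad (fun=> 0 : R) p = 0.
Proof.
apply/rowP => i; rewrite !mxE /pderiv.
by have [_ ->] := is_derive_cst (0 : R) p (delta_mx 0 i : 'rV[R]_d).
Qed.

Theorem theorem2p1 (R : realType) (X : pfinType) (d : nat) (hd : (0 < d)%N)
  (pi : probability (discrete_fin X) R) (rho : probability (borel_rV R d) R)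
  (Q : X -> X -> 'rV[R]_d -> R) (mu : X -> 'rV[R]_d -> 'rV[R]_d)
  (hQ : forall p : 'rV[R]_d, rate_matrix Q p)
  (hQ2 : forall x y : X, (Q x y : borel_rV R d -> R) \in L2 rho)
  (hmu2 : forall (x : X) (i : 'I_d),
     ((fun p => mu x p 0 i) : borel_rV R d -> R) \in L2 rho)
  (gamma : R) (hgamma : 0 <= gamma)
  (S : R -> R.-pker (borel_rV R d) ~> (borel_rV R d))
  (DD : set (borel_rV R d -> R)) (LD : (borel_rV R d -> R) -> borel_rV R d -> R)
  (hS : has_generator rho S DD LD)
  (hSrho : invariant_measure rho S)
  (hDD : forall f : 'rV[R]_d -> R, test_rV f -> DD f)
  (P : R -> R.-pker (phase X R d) ~> (phase X R d))
  (D : set (phase X R d -> R)) (L : (phase X R d -> R) -> phase X R d -> R)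
  (hP : has_generator (pi \x rho)%E P D L)
  (hPuniq : unique_process (pi \x rho)%E P D L)
  (hL : forall f : phase X R d -> R, test_phase f ->
     {ae (pi \x rho)%E, forall z, L f z = LH Q mu f z + gamma * lift_p LD f z})
  (hcore : is_core (pi \x rho)%E D L [set f | test_phase f])
  (hQsupp : forall x y : X, ~ ([set x; y] `<=` psupp pi) ->
     forall p : 'rV[R]_d, Q x y p = 0) :
  invariant_measure (pi \x rho)%E P <->
  {ae pi, forall x : discrete_fin X, weighted_div_eq rho (mu x) (q_ pi Q x)}.
Proof.
have [Str SC0 SDE SDL] := hS; have [Ptr PC0 DE DL] := hP.
pose m : probability (phase X R d) R := (pi \x rho)%E.
(* The defect at [x] in the weak divergence equation tested on the section of [f] at [x]. *)
pose A f x := \int[rho]_p dotp (grad (fun p => f (x, p)) p) (mu x p) +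
  \int[rho]_p (f (x, p) * q_ pi Q x p).
have LE f : test_phase f -> \int[m]_z L f z = \sum_x pmass pi x * A f x.
  move=> tf; have Df : D f by exact: hcore.1.
  have [_ Lf2 _] := DL _ Df.
  have LD0 x : \int[rho]_p LD (fun p => f (x, p)) p = 0.
    apply: (invariant_generator_Rintegral SC0 SDL hSrho); exact: hDD.
  have iLD x : rho.-integrable setT (EFin \o (fun p => lift_p LD f (x, p))).
    by have [_ LD2 _] := SDL _ (hDD _ (tf x)); exact: L2_integrable LD2.
  have iH := integrable_phase pi (integrable_LH_section hQ2 hmu2 tf).
  have iG := integrable_phase pi iLD.
  have iZ := integrableZl measurableT gamma iG.
  transitivity (\int[m]_z (LH Q mu f z + gamma * lift_p LD f z)).
    congr fine; apply: ae_eq_integral => //.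
    - by apply/measurable_EFinP; exact: L2_measurable Lf2.
    - exact: (measurable_int _ (integrableD measurableT iH iZ)).
    - by apply: filterS (hL _ tf) => z ->.
  rewrite RintegralD// RintegralZl// (Rintegral_phase pi iLD) /=.
  rewrite [X in gamma * X]big1 ?mulr0 ?addr0; last by move=> x _; rewrite LD0 mulr0.
  exact: Rintegral_LH.
split=> [inv|/ae_discrete_finP H].
  apply/ae_discrete_finP => x x0 g tg.
  pose f := fun z : phase X R d => if (z.1 : X) == x then g z.2 else 0.
  have tf : test_phase f by exact: test_phase_indicator.
  have fx : (fun p => f (x, p)) = g by apply/funext => p; rewrite /f /= eqxx.
  have fy y : y != x -> (fun p => f (y, p)) = (fun=> 0).
    by move=> yx; apply/funext => p; rewrite /f /= (negbTE yx).
  have := LE f tf.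
  rewrite (invariant_generator_Rintegral PC0 DL inv); last exact: hcore.1.
  rewrite (bigD1 x)//= big1 ?addr0; last first.
    move=> y yx; rewrite /A fy//.
    rewrite (_ : \int[rho]_p _ = \int[rho]__ (0 : R)); last first.
      apply: eq_Rintegral => p _; rewrite grad0 /dotp big1// => i _.
      by rewrite mxE mul0r.
    rewrite (_ : \int[rho]_p (f (y, p) * q_ pi Q y p) = \int[rho]__ (0 : R));
      last first.
      by apply: eq_Rintegral => p _; rewrite /f /= (negbTE yx) mul0r.
    by rewrite Rintegral_cst// mul0r addr0 mulr0.
  move=> /esym/eqP; rewrite mulf_eq0 gt_eqF//= /A fx addr_eq0 => /eqP ->.
  by congr (- _); apply: eq_Rintegral => p _; rewrite /f /= eqxx.
(* The vanishing is required on all of [D], since [P_s f] need not be a test function when [f] is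
   one. *)
have L0 f : D f -> \int[m]_z L f z = 0.
  apply: (core_generator_Rintegral DL hcore) => {}f tf.
  rewrite LE// big1// => x _.
  have [x0|x0] := eqVneq (pmass pi x) 0; first by rewrite x0 mul0r.
  have xs : 0 < pmass pi x by rewrite lt_neqAle eq_sym x0 pmass_ge0.
  by rewrite /A (H x xs _ (tf x)) addNr mulr0.
move=> t t0 B mB; rewrite -(lawE m P t mB).
apply: test_measure_unique => //.
- exact: law_setT.
- exact: (probability_setT m).
- move=> f tf; apply: (generator_invariant_Rintegral Ptr PC0 DE DL L0 t0).
  exact: hcore.1.
Qed.
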